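(* Let $(q_n)$ be a sequence of positive integers with $q_n\to\infty$ and $q_n=n^{o(1)}$ (i.e. $\log q_n/\log n\to 0$). Let $G_n$, $n\ge 1$, be independent random graphs, $G_n$ uniformly distributed on $G(n,q_n+1)$. Then, almost surely, the normalized spectral measures $\mu_n=\mu(G_n)$ satisfy $W_p(\mu_n,\mu_\infty)\to 0$ as $n\to\infty$ for every $p\in[1,\infty)$, where $\mu_\infty$ is the semicircle distribution.
   Context: $G(n,q+1)$ denotes the set of all $(q+1)$-regular simple graphs on $n$ vertices (the random graph $G_n$ is taken uniform on this set, for those $n$ where it is nonempty). For a finite $(q+1)$-regular graph $H$ with $m$ vertices and adjacency eigenvalues $\lambda_1,\dots,\lambda_m$, the normalized spectral measure is $\mu(H)=\frac1m\sum_k\delta_{q^{-1/2}\lambda_k}$ (here $q=q_n$). Semicircle distribution: $d\mu_\infty(x)=\frac{1}{2\pi}\sqrt{4-x^2}\mathbf 1_{|x|\le 2}dx$. For probability measures $\mu,\nu$ on $\mathbb{R}$ with finite $p$-th moments, $W_p(\mu,\nu)=\inf_{\gamma}\big(\int|x-y|^pd\gamma(x,y)\big)^{1/p}$, the infimum over all couplings $\gamma$ of $\mu$ and $\nu$. *)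

(* Defs.v *)
From HB Require Import structures.
From mathcomp Require Import all_boot all_order all_algebra.
From mathcomp Require Import all_classical all_reals all_analysis.
Set Implicit Arguments. Unset Strict Implicit. Unset Printing Implicit Defensive.
Import Order.TTheory GRing.Theory Num.Theory.
Import numFieldNormedType.Exports.
Local Open Scope classical_set_scope.
Local Open Scope ring_scope.

Definition graph (n : nat) := {ffun 'I_n * 'I_n -> bool}.

Definition regular_graph (n k : nat) (g : graph n) : bool :=
  [&& [forall i, ~~ g (i, i)],
      [forall i, forall j, g (i, j) == g (j, i)] &
      [forall i, #|[set j | g (i, j)]| == k]].

Definition Greg (n k : nat) : {set graph n} := [set g | regular_graph k g].

Definition adjmx (R : realType) (n : nat) (g : graph n) : 'M[R]_n :=
  \matrix_(i, j) (g (i, j))%:R.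

(* normalized spectral measure mu(H) = (1/n) sum_k delta_{q^{-1/2} lambda_k},
   the eigenvalues lambda_k counted with multiplicity (= root multiplicity in
   the characteristic polynomial of the symmetric adjacency matrix). *)
Definition spectral_measure (R : realType) (q n : nat) (g : graph n)
  : set R -> \bar R :=
  fun B =>
    ((\sum_(x \in [set x | root (char_poly (adjmx R g)) x]
                 `&` ((fun y => y / Num.sqrt (q%:R : R)) @^-1` B))
        ((mup x (char_poly (adjmx R g)))%:R : R)) / n%:R)%:E.

Definition semicircle (R : realType) : set R -> \bar R :=
  fun B => (\int[@lebesgue_measure R]_(x in B `&` [set x : R | (`|x| <= 2)%R])
              (((2 * pi)^-1 * Num.sqrt (4 - x ^+ 2))%:E))%E.

Definition coupling (R : realType) (mu nu : set R -> \bar R)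
  (g : probability (R * R)%type R) : Prop :=
  forall A : set R, measurable A ->
    g (A `*` setT) = mu A /\ g (setT `*` A) = nu A.

Definition Wasserstein (R : realType) (p : R) (mu nu : set R -> \bar R) : \bar R :=
  poweR (ereal_inf [set (\int[g]_(z in setT) ((`|z.1 - z.2| `^ p)%:E))%E
                    | g in [set g | coupling mu nu g]]) p^-1.

Definition good (q : nat -> nat) (n : nat) : bool :=
  (0 < n)%N && (Greg n (q n).+1 != finset.set0).

(* Main.v *)
Require Import Defs.
From HB Require Import structures.
From mathcomp Require Import all_boot all_order all_algebra.
From mathcomp Require Import all_classical all_reals all_analysis.
From mathcomp Require Import measurable_realfun.
From mathcomp Require Import perm sesquilinear spectral complex.
From mathcomp Require Import zify ring lra.
Set Implicit Arguments. Unset Strict Implicit. Unset Printing Implicit Defensive.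
Import Order.TTheory GRing.Theory Num.Theory.
Import numFieldNormedType.Exports.
Local Open Scope classical_set_scope.
Local Open Scope ring_scope.

(* Write d = q + 1, let A be the adjacency matrix of a d-regular graph and let
S_r be the polynomial with S_r(2 cos t) = sin((r+1)t) / sin t. The matrix
q^(r/2) S_r(A / sqrt q) is the sum of the matrices counting non-backtracking
walks of lengths r, r-2, r-4, ... Since S_r has semicircle mean 0 for r > 0, and
the S_r span all polynomials, the moments of the spectral measure converge to
those of the semicircle law as soon as, for each length L, the graph has O(n)
closed non-backtracking walks of length at most L. Such a walk contains a cycle
of length at most L, so it is enough that few vertices lie on short cycles.

Switching two edges shows that a given set of s edges is contained in the
uniform d-regular graph with probability at most (2d/n)^s. Hence the number of
pairs of disjoint short cycles has expectation n^o(1), so that the number of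
vertices on short cycles exceeds n / d^m with probability at most n^(-2+o(1)),
which is summable; the first moment alone would only give n^(-1+o(1)).

Given convergence of moments, explicit polynomials approximating the indicator
functions of half-lines compare the distribution functions, and the monotone
transport map from the semicircle law to the sorted eigenvalues then bounds the
Wasserstein distance; high moments control the tails. *)

(** * Switchings *)

Section Switching.
Local Open Scope nat_scope.
Local Open Scope set_scope.
Variables n d : nat.
Implicit Types (g : graph n) (u v x y : 'I_n) (S : seq ('I_n * 'I_n)).

Lemma leq_card_predU (T : finType) (A B : pred T) : #|[predU A & B]| <= #|A| + #|B|.
Proof. by rewrite -cardUI leq_addr. Qed.

Lemma regular_graphP g : reflect
  [/\ forall i, ~~ g (i, i), forall i j, g (i, j) = g (j, i) &
      forall i, #|[pred j | g (i, j)]| = d]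
  (regular_graph d g).
Proof.
have eqc i : #|[set j | g (i, j)]%classic| = #|[pred j | g (i, j)]|.
  by apply: eq_card => j; rewrite !inE; apply/idP/idP => [|h]; rewrite ?inE //= in_setE.
apply: (iffP and3P) => [[/forallP h1 /forallP h2 /forallP h3]|[h1 h2 h3]]; split => //.
- by move=> i j; apply/eqP; move/forallP: (h2 i).
- by move=> i; rewrite -eqc; apply/eqP.
- exact/forallP.
- by apply/forallP => i; apply/forallP => j; apply/eqP.
- by apply/forallP => i; rewrite eqc h3.
Qed.

Definition switch_perm u v x y (a : 'I_n) : {perm 'I_n} :=
  if a == u then tperm v x else if a == v then tperm u y
  else if a == x then tperm y u else if a == y then tperm x v else perm_one _.

(* Replaces the edges uv and xy by ux and vy. Written as a row-wise
   permutation, it is visibly an involution preserving all degrees. *)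
Definition switch u v x y g : graph n :=
  [ffun p => g (p.1, switch_perm u v x y p.1 p.2)].

Lemma switchK u v x y : involutive (switch u v x y).
Proof.
move=> g; apply/ffunP => -[a b]; rewrite !ffunE /=; congr (g (a, _)).
rewrite /switch_perm; do !case: ifP => _; rewrite ?tpermK ?perm1 //.
Qed.

(** Degrees survive because each row is only permuted. Symmetry needs the values of [g] at all four
    pairs: the new entry at [(u, x)] is read from [g (u, v)] and its mirror from [g (x, y)], while
    those at [(u, v)] and [(v, u)] are read from the two non-edges. *)
Lemma switch_regular u v x y g : uniq [:: u; v; x; y] -> g (u, v) -> g (x, y) ->
  ~~ g (u, x) -> ~~ g (v, y) -> regular_graph d g ->
  regular_graph d (switch u v x y g).
Proof.
rewrite /= !inE !negb_or andbT -!andbA => /and5P[uv ux uy vx /andP[vy xy]].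
move=> guv gxy /negbTE gux /negbTE gvy /regular_graphP[irr sym deg].
have gE := (gux, gvy, guv, gxy, etrans (sym v u) guv, etrans (sym y x) gxy,
  etrans (sym x u) gux, etrans (sym y v) gvy).
have nE := (negbTE uv, negbTE ux, negbTE uy, negbTE vx, negbTE vy, negbTE xy,
  etrans (eq_sym v u) (negbTE uv), etrans (eq_sym x u) (negbTE ux),
  etrans (eq_sym y u) (negbTE uy), etrans (eq_sym x v) (negbTE vx),
  etrans (eq_sym y v) (negbTE vy), etrans (eq_sym y x) (negbTE xy)).
apply/regular_graphP; split.
- move=> i; rewrite ffunE /= /switch_perm.
  have [->|iu] := eqVneq i u; first by rewrite tpermD // eq_sym ?nE.
  have [->|iv] := eqVneq i v; first by rewrite tpermD // ?nE.
  have [->|ix] := eqVneq i x; first by rewrite tpermD // ?nE.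
  have [->|iy] := eqVneq i y; first by rewrite tpermD // ?nE.
  by rewrite perm1.
- have cases z : [\/ z = u, z = v, z = x | z = y \/
      [/\ (z == u) = false, (z == v) = false, (z == x) = false & (z == y) = false]].
    have [->|zu] := eqVneq z u; first exact: Or41.
    have [->|zv] := eqVneq z v; first exact: Or42.
    have [->|zx] := eqVneq z x; first exact: Or43.
    by have [->|zy] := eqVneq z y; [apply: Or44; left|apply: Or44; right].
  move=> i j; rewrite !ffunE /= /switch_perm.
  case: (cases i) => [->|->|->|[->|[i1 i2 i3 i4]]];
  case: (cases j) => [->|->|->|[->|[j1 j2 j3 j4]]];
  rewrite ?eqxx ?nE ?(i1, i2, i3, i4) ?(j1, j2, j3, j4) ?nE ?perm1 ?tpermL ?tpermR
    ?tpermD ?gE // 1?eq_sym ?nE //;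
  by rewrite ?(i1, i2, i3, i4) ?(j1, j2, j3, j4).
move=> i; rewrite -(deg i) -(card_imset _ (@perm_inj _ (switch_perm u v x y i))).
apply: eq_card => j; rewrite !inE; apply/imsetP/idP => [[k] | gij].
  by rewrite !inE ffunE /= => h ->.
have inv : involutive (switch_perm u v x y i).
  by move=> k; rewrite /switch_perm; do !case: ifP => _; rewrite ?tpermK ?perm1.
by exists (switch_perm u v x y i j); rewrite ?inE ?ffunE /= inv.
Qed.

Lemma switch_edge u v x y g p : uniq [:: u; v; x; y] ->
  ~~ g (u, x) -> ~~ g (v, y) -> (forall i j, g (i, j) = g (j, i)) ->
  p \notin [:: (u, v); (v, u); (x, y); (y, x)] -> g p -> switch u v x y g p.
Proof.
case: p => a b; rewrite /= !inE !negb_or andbT -!andbA => /and5P[uv ux uy vx /andP[vy xy]].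
move=> /negbTE gux /negbTE gvy sym; rewrite !xpair_eqE => /and4P[h1 h2 h3 h4] gab.
have [gxu gyv] := (etrans (sym x u) gux, etrans (sym y v) gvy).
rewrite ffunE /= /switch_perm.
case: eqVneq h1 => [au /= h1|_ _].
  rewrite tpermD // 1?eq_sym //; apply: contraTneq gab => ->; by rewrite au gux.
case: eqVneq h2 => [av /= h2|_ _].
  rewrite tpermD // 1?eq_sym //; apply: contraTneq gab => ->; by rewrite av gvy.
case: eqVneq h3 => [ax /= h3|_ _].
  rewrite tpermD // 1?eq_sym //; apply: contraTneq gab => ->; by rewrite ax gxu.
case: eqVneq h4 => [ay /= h4|_ _].
  rewrite tpermD // 1?eq_sym //; apply: contraTneq gab => ->; by rewrite ay gyv.
by rewrite perm1.
Qed.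

Lemma card_edges_fst g (P : pred 'I_n) : regular_graph d g ->
  #|[pred p | g p && P p.1]| = #|P| * d.
Proof.
case/regular_graphP=> _ _ deg.
rewrite -sum1_card (eq_bigl (fun p => P p.1 && g (p.1, p.2))); last first.
  by case=> a b; rewrite inE andbC.
rewrite -(pair_big_dep P (fun a b => g (a, b)) (fun _ _ => 1)) /=.
rewrite (eq_bigr (fun=> d)) ?sum_nat_const // => i _.
by rewrite sum1_card deg.
Qed.

Lemma card_edges_snd g (P : pred 'I_n) : regular_graph d g ->
  #|[pred p | g p && P p.2]| = #|P| * d.
Proof.
move=> rg; have [_ sym _] := regular_graphP _ rg.
rewrite -(card_edges_fst P rg).
have swK : involutive (fun p : 'I_n * 'I_n => (p.2, p.1)) by case.
rewrite -(card_imset _ (inv_inj swK)); apply: eq_card => -[a b].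
apply/imsetP/idP => [[[a' b']]|]; rewrite !inE /=.
  by move=> h [-> ->]; rewrite sym.
by move=> h; exists (b, a); rewrite ?inE //= sym.
Qed.

Definition graphs_with S := [set g in Greg n d | all (fun p => g p) S].

(** Double counting. With [x] and [y] recorded, switching is injective by [switchK], and it lands in
    graphs containing [S] where [x] is a neighbour of [u] and [y] one of [v], which leaves [d * d]
    choices per graph. In the other direction at least half of the [n * d] ordered edges [xy] are
    admissible. *)
Lemma switch_count u v S : u != v -> (u, v) \notin S -> (v, u) \notin S ->
  4 * (d + 2) + 4 * size S <= n -> 0 < d ->
  #|graphs_with ((u, v) :: S)| * n <= 2 * d * #|graphs_with S|.
Proof.
move=> uv uvS vuS hn d0.
pose ok g x y := [&& g (x, y), x \notin [:: u; v], y \notin [:: u; v],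
  ~~ g (u, x), ~~ g (v, y), (x, y) \notin S & (y, x) \notin S].
pose X := [set q : graph n * ('I_n * 'I_n) |
  (q.1 \in graphs_with ((u, v) :: S)) && ok q.1 q.2.1 q.2.2].
pose Y := [set q : graph n * ('I_n * 'I_n) |
  [&& q.1 \in graphs_with S, q.1 (u, q.2.1) & q.1 (v, q.2.2)]].
pose f (q : graph n * ('I_n * 'I_n)) := (switch u v q.2.1 q.2.2 q.1, q.2).
have f_inj : injective f.
  move=> [g [x y]] [g' [x' y']] [] /= E xx yy; subst.
  by rewrite -(switchK u v x' y' g) E switchK.
have XY : #|X| <= #|Y|.
  rewrite -(card_imset _ f_inj); apply: subset_leq_card; apply/fintype.subsetP => q.
  case/imsetP => -[g [x y]]; rewrite !inE /= => /andP[/andP[rg /andP[guv /allP gS]]].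
  case/and5P => gxy; rewrite !inE !negb_or => /andP[xu xv] /andP[yu yv] gux.
  case/and3P => gvy xyS yxS ->.
  have [irr sym _] := regular_graphP _ rg.
  have xy : x != y by apply: contraTneq gxy => ->; exact: irr.
  have un : uniq [:: u; v; x; y].
    by rewrite /= !inE !negb_or uv !(eq_sym u) !(eq_sym v) xu yu xv yv xy.
  rewrite /f /= switch_regular //=; apply/and3P; split.
  - apply/allP => p pS; apply: switch_edge => //; last exact: gS.
    rewrite !inE.
    by apply/negP => /or4P[] /eqP e; move: pS; apply/negP; rewrite e.
  - by rewrite ffunE /= /switch_perm eqxx tpermR.
  - by rewrite ffunE /= /switch_perm eqxx eq_sym (negbTE uv) tpermR sym.
have cY : #|Y| = d * d * #|graphs_with S|.
  rewrite -sum1_card (eq_bigl (fun q : graph n * ('I_n * 'I_n) =>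
    (q.1 \in graphs_with S) && (q.1 (u, q.2.1) && q.1 (v, q.2.2)))); last first.
    by case=> g p; rewrite inE.
  rewrite -(pair_big_dep (mem (graphs_with S))
    (fun g (p : 'I_n * 'I_n) => g (u, p.1) && g (v, p.2)) (fun _ _ => 1)) /=.
  rewrite (eq_bigr (fun=> d * d)) ?sum_nat_const 1?mulnC // => g.
  move=> gS; have /regular_graphP[_ _ deg] : regular_graph d g.
    by move: gS; rewrite !inE => /andP[].
  rewrite -(pair_big (fun x => g (u, x)) (fun y => g (v, y)) (fun _ _ => 1)) /=.
  under eq_bigr do rewrite sum1_card deg.
  by rewrite sum_nat_const deg.
(* At most [2 * (d + 2) * d + 2 * size S] ordered edges are inadmissible, and the lower bound on [n]
   makes this at most half of [n * d]. *)
have cX : #|graphs_with ((u, v) :: S)| * (n * d) <= 2 * #|X|.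
  rewrite -[#|X|]sum1_card (eq_bigl (fun q : graph n * ('I_n * 'I_n) =>
    (q.1 \in graphs_with ((u, v) :: S)) && ok q.1 q.2.1 q.2.2)); last first.
    by case=> g p; rewrite inE.
  rewrite -(pair_big_dep (mem (graphs_with ((u, v) :: S)))
    (fun g (p : 'I_n * 'I_n) => ok g p.1 p.2) (fun _ _ => 1)) /=.
  rewrite big_distrr /= -sum_nat_const; apply: leq_sum => g.
  move=> gS; have rg : regular_graph d g by move: gS; rewrite !inE => /andP[].
  rewrite sum1_card.
  have [irr sym deg] := regular_graphP _ rg.
  pose P w x := (x \in [:: u; v]) || g (w, x).
  have cP w : #|P w| <= d + 2.
    rewrite -(deg w) addnC; apply: leq_trans (leq_add (card_size [:: u; v]) (leqnn _)).
    by apply: leq_trans (leq_card_predU _ _); apply: subset_leq_card;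
      apply/fintype.subsetP => x; rewrite !inE.
  have total : #|[pred p | g p]| = n * d.
    rewrite -[X in _ = X * d](card_ord n) -(card_edges_fst predT rg).
    by apply: eq_card => p; rewrite !inE andbT.
  pose S2 := S ++ [seq (p.2, p.1) | p <- S].
  have : #|[pred p | g p]| <= #|[pred p : 'I_n * 'I_n | ok g p.1 p.2]|
     + (#|[pred p | g p && P u p.1]| + #|[pred p | g p && P v p.2]| + #|S2|).
    apply: leq_trans (leq_add (leqnn _)
      (leq_trans (leq_card_predU _ _) (leq_add (leq_card_predU _ _) (leqnn _)))).
    apply: leq_trans (leq_card_predU _ _); apply: subset_leq_card.
    apply/fintype.subsetP => -[x y]; rewrite !inE /= => gxy.
    rewrite gxy /ok /P !inE /= mem_cat.
    have -> : ((x, y) \in [seq (p.2, p.1) | p <- S]) = ((y, x) \in S).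
      by apply/mapP/idP => [[[a b] ab [-> ->]]|h] //; exists (y, x).
    rewrite ?gxy /=; move: (x == u) (x == v) (y == u) (y == v) (g (u, x)) (g (v, y))
      (_ \in S) (_ \in S).
    by do 8!case.
  rewrite total (card_edges_fst _ rg) (card_edges_snd _ rg) => h.
  have hS : #|S2| <= 2 * size S.
    by apply: leq_trans (card_size S2) _; rewrite size_cat size_map mul2n addnn.
  have h1 := leq_mul (cP u) (leqnn d); have h2 := leq_mul (cP v) (leqnn d).
  have h3 : (4 * (d + 2) + 4 * size S) * d <= n * d by rewrite leq_mul2r hn orbT.
  have h4 : size S <= size S * d by rewrite leq_pmulr.
  rewrite [X in 2 * X](_ : _ = #|[pred p : 'I_n * 'I_n | ok g p.1 p.2]|) //.
  move: h hS h1 h2 h3 h4; move: #|_| #|_| #|_| (size S) => a b c k; nia.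
rewrite -(leq_pmul2r d0) -mulnA; apply: leq_trans cX _.
by apply: leq_trans (leq_mul (leqnn 2) XY) _; rewrite cY; lia.
Qed.

(** Without loops, repetitions or reversals, the pairs stand for distinct undirected edges. Distinct
    first components are more than that requires, but they come for free when each vertex of a cycle
    is paired with its successor. *)
Definition simple_edges S :=
  uniq (unzip1 S) && all (fun p => (p.1 != p.2) && ((p.2, p.1) \notin S)) S.

(** Each edge removed through [switch_count] costs a factor [2 * d / n]; [simple_edges] guarantees
    that neither orientation of it remains in the list. *)
Lemma card_graphs_with S : simple_edges S ->
  4 * (d + 2) + 4 * size S <= n -> 0 < d ->
  #|graphs_with S| * n ^ size S <= (2 * d) ^ size S * #|Greg n d|.
Proof.
move=> + + d0; elim: S => [|[u v] S IH] /=.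
  rewrite !expn0 muln1 mul1n => _ _; apply: subset_leq_card.
  by apply/fintype.subsetP => g; rewrite inE => /andP[].
case/andP => /= /andP[uS unS] /andP[/andP[uv vuS] /allP aS] hn.
have hS : simple_edges S.
  rewrite /simple_edges unS; apply/allP => p pS.
  by have := aS p pS; rewrite inE negb_or => /and3P[-> _ ->].
have uvS : (u, v) \notin S by apply: contra uS => h; apply/mapP; exists (u, v).
move: vuS; rewrite inE negb_or => /andP[_ vuS].
have := switch_count uv uvS vuS _ d0; rewrite !expnS => -/(_ _)/wrap[]; first by lia.
have := IH hS _ => -/(_ _)/wrap[]; first by lia.
move=> h1 h2; rewrite mulnA; apply: leq_trans (leq_mul h2 (leqnn _)) _.
by rewrite -!mulnA !leq_mul2l h1 !orbT.
Qed.
End Switching.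

(** * Short cycles *)

Section ShortCycles.
Local Open Scope nat_scope.
Local Open Scope set_scope.
Variables n d : nat.
Implicit Types (g : graph n) (x y z : 'I_n) (c s : seq 'I_n) (A B : {set 'I_n}).

Definition adj g : rel 'I_n := fun x y => g (x, y).

Definition expand g A : {set 'I_n} := A :|: \bigcup_(y in A) [set z | g (y, z)].

Definition gball g i x : {set 'I_n} := iter i (expand g) [set x].

Lemma expandS g A B : A \subset B -> expand g A \subset expand g B.
Proof.
move=> AB; apply: finset.setUSS => //; apply/bigcupsP => y yA.
by apply: finset.bigcup_sup; exact: (fintype.subsetP AB).
Qed.

Lemma iter_expandS g i A B : A \subset B ->
  iter i (expand g) A \subset iter i (expand g) B.
Proof. by move=> AB; elim: i => //= i; exact: expandS. Qed.

Lemma gballD g i j x y z : y \in gball g i x -> z \in gball g j y ->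
  z \in gball g (j + i) x.
Proof.
move=> yx; rewrite /gball iterD; apply/fintype.subsetP; apply: iter_expandS.
by apply/fintype.subsetP => t; rewrite finset.in_set1 => /eqP ->.
Qed.

Lemma gball_refl g i x : x \in gball g i x.
Proof.
elim: i => [|i IH]; first by rewrite finset.in_set1.
by rewrite /= finset.in_setU; apply/orP; left.
Qed.

Lemma gball_leq g i j x y : i <= j -> y \in gball g i x -> y \in gball g j x.
Proof. by move=> ij h; rewrite -(subnK ij); apply: gballD h (gball_refl _ _ _). Qed.

Lemma gball_step g x y : g (x, y) -> y \in gball g 1 x.
Proof.
move=> gxy; rewrite /= finset.in_setU; apply/orP; right.
by apply/finset.bigcupP; exists x; rewrite ?finset.in_set1 // inE.
Qed.

Lemma gball_sym g i x y : (forall a b, g (a, b) = g (b, a)) ->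
  y \in gball g i x -> x \in gball g i y.
Proof.
move=> sym; elim: i y => [|i IH] y; first by rewrite !finset.in_set1 eq_sym.
rewrite [X in X -> _]/= finset.in_setU => /orP[/IH|/finset.bigcupP[z /IH xz]].
  exact: gball_leq.
by rewrite inE sym => /gball_step yz; rewrite -addn1; exact: gballD yz xz.
Qed.

Lemma path_gball g x s z : path (adj g) x s -> z \in x :: s ->
  z \in gball g (size s) x.
Proof.
elim: s x => [|y s IH] x /=; first by rewrite mem_seq1 => _ /eqP ->; rewrite finset.in_set1.
move=> /andP[xy ys]; rewrite in_cons => /orP[/eqP ->|zs].
  exact: (gball_refl g (size s).+1).
have := gballD (gball_step xy) (IH y ys zs); by rewrite addn1.
Qed.

Lemma card_gball g i x : regular_graph d g -> #|gball g i x| <= d.+1 ^ i.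
Proof.
case/regular_graphP => _ _ deg; elim: i => [|i IH]; first by rewrite cards1.
rewrite expnSr; apply: leq_trans (leq_mul IH (leqnn _)).
rewrite /= /expand -/(gball g i x) mulnS; apply: leq_trans (leq_card_setU _ _) _.
rewrite leq_add2l -sum_nat_const; elim/big_rec2: _ => [|y A m _ h].
  by rewrite cards0.
apply: leq_trans (leq_card_setU _ _) _; rewrite leq_add // -(deg y).
by apply/eq_leq; apply: eq_card => z; rewrite finset.in_set.
Qed.

Definition cycle_edges c := [seq (z, next c z) | z <- c].

(** This is where length at least 3 enters: the reverse of an edge of the cycle is then not an edge
    of the cycle in its orientation. *)
Lemma next_next_neq c z : uniq c -> 2 < size c -> z \in c -> next c (next c z) != z.
Proof.
move=> uc sc zc; have [i c' ci] := rot_to zc.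
rewrite -!(next_rot i uc) ci; rewrite -(rot_uniq i) ci in uc.
rewrite -(size_rot i) ci in sc.
case: c' uc sc {ci} => [|a [|b c']] //= /andP[]; rewrite !inE !negb_or.
case/and3P => za zb _ /andP[/andP[ab _] _] _.
by rewrite /next /= ?eqxx (eq_sym a) (negbTE za) eq_sym.
Qed.

(** The first components are the vertices themselves. A reversed edge starts at a vertex of its own
    cycle, so it cannot belong to the other one, and [next_next_neq] excludes it from its own. *)
Lemma simple_cycle_edges c1 c2 : uniq (c1 ++ c2) -> 2 < size c1 -> 2 < size c2 ->
  simple_edges (cycle_edges c1 ++ cycle_edges c2).
Proof.
move=> uc s1 s2; have := uc; rewrite cat_uniq => /and3P[u1 /hasPn u12 u2].
have fstE c : unzip1 (cycle_edges c) = c by rewrite /unzip1 -map_comp map_id.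
have neq c z : uniq c -> 2 < size c -> z \in c ->
    (z != next c z) && ((next c z, z) \notin cycle_edges c).
  move=> u s zc; have := next_next_neq u s zc => h; apply/andP; split.
    by apply: contra h => /eqP e; rewrite -!e.
  by apply/negP => /mapP[w _ [e1 e2]]; move: h; rewrite e1 -e2 eqxx.
have other c c' z : next c z \notin c' -> (next c z, z) \notin cycle_edges c'.
  by apply: contra => /mapP[w wc [-> _]].
rewrite /simple_edges /unzip1 map_cat -!/(unzip1 _) !fstE uc /= all_cat.
apply/andP; split; apply/allP => p /mapP[z zc ->] /=; rewrite mem_cat negb_or.
  have /andP[-> ->] := neq _ _ u1 s1 zc; rewrite other //.
  by apply/negP => /u12; rewrite mem_next zc.
have /andP[-> ->] := neq _ _ u2 s2 zc; rewrite andbT other //.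
by apply: u12; rewrite mem_next.
Qed.

Lemma cycle_edgesP g c : cycle (adj g) c -> all (fun p => g p) (cycle_edges c).
Proof. by move=> gc; apply/allP => p /mapP[z zc ->]; exact: next_cycle gc zc. Qed.

Variable k : nat.

(** The tuple omits [x], so these cycles have length [k.+1]. For [k = 1] any edge of a symmetric
    graph would qualify, hence the condition [2 <= k] below. *)
Definition on_cycle g : {set 'I_n} :=
  [set x | [exists s : k.-tuple 'I_n, uniq (x :: s) && cycle (adj g) (x :: s)]].

Local Notation marked := ('I_n * k.-tuple 'I_n)%type.
Definition cycle_of (p : marked) : seq 'I_n := p.1 :: p.2.

Definition disjoint_cycles g : {set marked * marked} :=
  [set q | [&& uniq (cycle_of q.1 ++ cycle_of q.2),
     cycle (adj g) (cycle_of q.1) & cycle (adj g) (cycle_of q.2)]].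

(** Split the pairs of vertices on cycles by distance. At most [d.+1 ^ (2 * k)] vertices lie within
    [2 * k] of a given one. If two vertices are further apart, any cycles through them are disjoint,
    since a common vertex would be within [k] of both. *)
Lemma card_on_cycle_sq g : regular_graph d g ->
  #|on_cycle g| ^ 2 <= #|disjoint_cycles g| + #|on_cycle g| * d.+1 ^ (2 * k).
Proof.
move=> rg; have [_ sym _] := regular_graphP _ _ rg.
pose V := on_cycle g.
pose near_ x := gball g (2 * k) x.
pose F := [set p : 'I_n * 'I_n | [&& p.1 \in V, p.2 \in V & p.2 \notin near_ p.1]].
pose N := [set p : 'I_n * 'I_n | (p.1 \in V) && (p.2 \in near_ p.1)].
have cN : #|N| <= #|V| * d.+1 ^ (2 * k).
  rewrite -sum1_card (eq_bigl (fun p : 'I_n * 'I_n => (p.1 \in V) && (p.2 \in near_ p.1)));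
    last by move=> p; rewrite inE.
  rewrite -(pair_big_dep (mem V) (fun x y => y \in near_ x) (fun _ _ => 1)) /=.
  rewrite -sum_nat_const; apply: leq_sum => x _; rewrite sum1_card; exact: card_gball.
have cF : #|F| <= #|disjoint_cycles g|.
  apply: leq_trans (leq_imset_card (fun q : marked * marked => (q.1.1, q.2.1)) _).
  apply: subset_leq_card; apply/fintype.subsetP => -[x y].
  rewrite !inE /= => /and3P[/existsP[s /andP[us cs]] /existsP[t /andP[ut ct]] xy].
  apply/imsetP; exists ((x, s), (y, t)) => //.
  rewrite finset.in_set; apply/and3P; split; [|exact: cs|exact: ct].

  rewrite -[cycle_of _ ++ _]/((x :: s) ++ (y :: t)) cat_uniq (us : uniq (x :: s) = true) (ut : uniq (y :: t) = true) andbT andTb.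
  apply: contra xy => /hasP[z zt] zs.
  have b1 : z \in gball g k x.
    rewrite -{1}(size_tuple s); apply: path_gball => //.
    by move: cs; rewrite /= rcons_path => /andP[].
  have b2 : z \in gball g k y.
    rewrite -{1}(size_tuple t); apply: path_gball => //.
    by move: ct; rewrite /= rcons_path => /andP[].
  by rewrite /near_ /= mul2n -addnn; exact: gballD b1 (gball_sym sym b2).
rewrite -/V; apply: leq_trans (leq_add cF cN).
apply: leq_trans (leq_card_setU F N).
rewrite expnS expn1 -cardsX; apply: subset_leq_card; apply/fintype.subsetP => p.
by rewrite !inE => /andP[-> ->] /=; case: (_ \in near_ _).
Qed.

(** After exchanging the sums, each of the at most [n ^ (2 * k.+1)] pairs of vertex sequences
    prescribes [2 * k.+1] simple edges, so the powers of [n] cancel against [card_graphs_with]. *)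
Lemma sum_card_disjoint_cycles : 2 <= k -> 0 < d ->
  4 * (d + 2) + 4 * (2 * k.+1) <= n ->
  \sum_(g in Greg n d) #|disjoint_cycles g| <= (2 * d) ^ (2 * k.+1) * #|Greg n d|.
Proof.
move=> k2 d0 hn.
have n0 : 0 < n by apply: leq_trans hn; rewrite addn_gt0 muln_gt0 addn_gt0 orbT.
under eq_bigr do rewrite -sum1_card.
pose T := (marked * marked)%type.
rewrite (exchange_big_dep (fun q : T => uniq (cycle_of q.1 ++ cycle_of q.2))) /=; last first.
  by move=> g q _; rewrite inE => /and3P[].
rewrite -(leq_pmul2r (_ : 0 < n ^ (2 * k.+1))) ?expn_gt0 ?n0 //.
rewrite big_distrl /=.
apply: (@leq_trans (\sum_(q : T) (2 * d) ^ (2 * k.+1) * #|Greg n d|)).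
  rewrite big_mkcond; apply: leq_sum => q _; case: ifP => // uq.
  rewrite sum1_card.
  have sz (p : marked) : size (cycle_of p) = k.+1 by rewrite /= size_tuple.
  have E := @simple_cycle_edges (cycle_of q.1) (cycle_of q.2) uq.
  rewrite !sz !ltnS in E.
  have size_E : size (cycle_edges (cycle_of q.1) ++ cycle_edges (cycle_of q.2)) = 2 * k.+1.
    by rewrite size_cat !size_map !sz addnn mul2n.
  have := @card_graphs_with n d _ (E k2 k2); rewrite size_E => /(_ hn d0).
  apply: leq_trans; rewrite leq_mul2r; apply/orP; right.
  apply: subset_leq_card; apply/fintype.subsetP => g.
  rewrite unfold_in => /andP[gG]; rewrite inE => /and3P[_ c1 c2].
  by rewrite inE gG all_cat !cycle_edgesP.
rewrite sum_nat_const mulnC leq_mul2l; apply/orP; right.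
by rewrite !card_prod card_tuple card_ord -expnS mul2n -addnn expnD.
Qed.

(** Markov's inequality for the number of disjoint pairs of cycles. Using pairs rather than single
    cycles is what produces the factor [n ^ 2]. *)
Lemma card_many_on_cycle m : 2 <= k -> 0 < d ->
  4 * (d + 2) + 4 * (2 * k.+1) <= n -> 2 * d.+1 ^ (2 * k + m) <= n ->
  #|[set g in Greg n d | n < #|on_cycle g| * d.+1 ^ m]| * n ^ 2 <=
  2 * d.+1 ^ (2 * m) * ((2 * d) ^ (2 * k.+1) * #|Greg n d|).
Proof.
move=> k2 d0 hn hm; rewrite -sum1_card big_distrl /=.
apply: leq_trans (leq_mul (leqnn _) (sum_card_disjoint_cycles k2 d0 hn)).
rewrite big_distrr /= [X in _ <= X](bigID (fun g => n < #|on_cycle g| * d.+1 ^ m)) /=.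
apply: leq_trans (leq_addr _ _).
rewrite [X in _ <= X](eq_bigl (mem [set g in Greg n d | n < #|on_cycle g| * d.+1 ^ m]));
  last by move=> g; rewrite !inE.
apply: leq_sum => g; rewrite finset.in_set mul1n => /andP[gG big].
have rg : regular_graph d g by move: gG; rewrite finset.in_set.
have sq := card_on_cycle_sq rg.
move: sq big hm; rewrite expnD (_ : d.+1 ^ (2 * m) = (d.+1 ^ m) ^ 2); last by rewrite -expnM mulnC.
set v := #|on_cycle g|; set D := #|disjoint_cycles g|.
move: v D (d.+1 ^ (2 * k)) (d.+1 ^ m) => v D a b sq big hm.
have h1 : n ^ 2 <= (v * b) ^ 2 by rewrite leq_sqr ltnW.
apply: leq_trans h1 _.
(* With so many vertices on cycles, the nearby pairs make up at most half of [v ^ 2], so disjoint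
   pairs account for the rest. *)
have h2 : 2 * a <= v.
  rewrite -(@leq_pmul2r b); last by case: b big {hm} => //; rewrite muln0.
  by rewrite -mulnA; apply: leq_trans hm (ltnW big).
have h3 : 2 * (v * a) <= v ^ 2 by rewrite mulnCA expnS expn1 leq_mul2l h2 orbT.
have h4 : v ^ 2 <= 2 * D by lia.
by rewrite expnMn -mulnA [b ^ 2 * D]mulnC mulnA leq_mul2r h4 orbT.
Qed.
End ShortCycles.

(** * Non-backtracking walks *)

Lemma leq_card_bigcup (I T : finType) (P : pred I) (F : I -> {set T}) :
  (#|(\bigcup_(i | P i) F i)%SET| <= \sum_(i | P i) #|F i|)%N.
Proof.
elim/big_rec2: _ => [|i m B _ h]; first by rewrite cards0.
by apply: leq_trans (leq_card_setU _ _) _; rewrite leq_add2l.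
Qed.

Section NonBacktracking.
Variables (R : realType) (n : nat) (g : graph n).
Local Notation A := (adjmx R g).
Implicit Types (a b c e : 'I_n) (r : nat).

(* Counts the non-backtracking walks of length r.+1 from a whose last step is
   c -> b. *)
Fixpoint nb_last r a c b : R :=
  if r is r'.+1 then A c b * \sum_(e | e != b) nb_last r' a e c
  else (a == c)%:R * A c b.

Definition nb_mx r : 'M[R]_n :=
  if r is r'.+1 then \matrix_(a, b) \sum_c nb_last r' a c b else 1%:M.

Lemma nb_last_ge0 r a c b : 0 <= nb_last r a c b.
Proof.
elim: r a c b => [|r IH] a c b /=; rewrite mxE mulr_ge0 ?ler0n //.
exact: sumr_ge0.
Qed.

Lemma nb_last_edge r a c b : A c b * nb_last r a c b = nb_last r a c b.
Proof.
have sq : A c b * A c b = A c b by rewrite mxE; case: (g _); rewrite ?mulr1 ?mulr0.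
by case: r => [|r] /=; [rewrite mulrCA sq|rewrite mulrA sq].
Qed.

(** The sum over [e != b] is completed to a full row sum; the correction counts walks whose last
    step is [b -> c], the ones that would backtrack. *)
Lemma nb_lastS r a c b : nb_last r.+1 a c b =
  A c b * (nb_mx r.+1 a c - nb_last r a b c).
Proof.
rewrite [nb_mx r.+1 a c]mxE /=; congr (_ * _).
by rewrite [in RHS](bigD1 b) //= addrAC subrr add0r.
Qed.

Section Regular.
Variable d : nat.
Hypothesis rg : regular_graph d g.

Let irr : forall i, ~~ g (i, i). Proof. by case/regular_graphP: rg. Qed.
Let sym : forall i j, g (i, j) = g (j, i). Proof. by case/regular_graphP: rg. Qed.
Let deg : forall i, #|[pred j | g (i, j)]| = d. Proof. by case/regular_graphP: rg. Qed.

Lemma adjmx_sym a b : A a b = A b a.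
Proof. by rewrite !mxE sym. Qed.

Lemma adjmx_row a : \sum_b A a b = d%:R.
Proof.
under eq_bigr do rewrite mxE; rewrite -natr_sum -(deg a) -sum1_card; congr (_%:R).
rewrite [RHS]big_mkcond; apply: eq_bigr => b _; rewrite inE; by case: (g _).
Qed.

Lemma nb_mx_rec r : nb_mx r.+2 =
  nb_mx r.+1 *m A - (\matrix_(a, b) \sum_c nb_last r a b c).
Proof.
apply/matrixP => a b; rewrite [LHS]mxE [RHS]mxE.
under eq_bigr do rewrite nb_lastS mulrBr; rewrite big_split /=; congr (_ + _).
  by rewrite [RHS]mxE; apply: eq_bigr => c _; rewrite mulrC.
rewrite sumrN [RHS]mxE; congr (- _); rewrite [RHS]mxE.
by apply: eq_bigr => c _; rewrite adjmx_sym nb_last_edge.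
Qed.

Lemma nb_mx1 : nb_mx 1 = A.
Proof.
apply/matrixP => a b; rewrite [LHS]mxE (bigD1 a) //= eqxx mul1r big1 ?addr0 //.
by move=> c ca; rewrite eq_sym (negbTE ca) mul0r.
Qed.

(** Every one of the [d] first steps can be reversed, so [d] is subtracted here, against [d - 1] in
    the general recursion. *)
Lemma nb_mx2 : nb_mx 2 = A *m A - d%:R%:M.
Proof.
rewrite nb_mx_rec nb_mx1; congr (_ - _); apply/matrixP => a b.
by rewrite !mxE /= -mulr_sumr adjmx_row mulr_natl mulrb; case: (a == b).
Qed.

(** A walk of positive length ending at [b] may be prolonged to any neighbour except its previous
    vertex and then sent back to [b]: these are the [d - 1] backtracking continuations to remove. *)
Lemma nb_mxSSS r : nb_mx r.+3 = nb_mx r.+2 *m A - (d%:R - 1) *: nb_mx r.+1.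
Proof.
rewrite nb_mx_rec; congr (_ - _); apply/matrixP => a b.
rewrite [LHS]mxE [RHS]mxE; under eq_bigr do rewrite nb_lastS mulrBr.
rewrite big_split /= -mulr_suml sumrN.
rewrite adjmx_row mulrBl mul1r; congr (_ - _).
by rewrite [RHS]mxE; apply: eq_bigr => c _; rewrite adjmx_sym nb_last_edge.
Qed.

Lemma nb_mx_ge0 r a b : 0 <= nb_mx r a b.
Proof.
case: r => [|r]; first by rewrite mxE ler0n.
by rewrite mxE sumr_ge0 // => c _; exact: nb_last_ge0.
Qed.

Lemma nb_mx_row r a : \sum_b nb_mx r a b <= d%:R ^+ r.
Proof.
elim: r => [|r IH].
  rewrite expr0 (bigD1 a) //= mxE eqxx big1 ?addr0 // => b ba.
  by rewrite mxE eq_sym (negbTE ba).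
have -> : \sum_b nb_mx r.+1 a b = \sum_c \sum_b nb_last r a c b.
  by under eq_bigr do rewrite mxE; rewrite exchange_big.
rewrite exprSr; apply: le_trans (ler_wpM2r (ler0n _ _) IH).
rewrite mulr_suml; apply: ler_sum => c _; case: r {IH} => [|r].
  rewrite [nb_mx 0 a c]mxE /= -mulr_sumr adjmx_row; exact: lexx.
rewrite -(adjmx_row c) mulr_sumr; apply: ler_sum => b _; rewrite nb_lastS mulrC.
apply: ler_wpM2r; first by rewrite mxE ler0n.
by rewrite gerBl nb_last_ge0.
Qed.

Lemma nb_mx_diag_le r a : nb_mx r a a <= d%:R ^+ r.
Proof.
apply: le_trans (nb_mx_row r a); rewrite (bigD1 a) //= lerDl.
by apply: sumr_ge0 => b _; exact: nb_mx_ge0.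
Qed.

Lemma nb_last_walk r a c b : nb_last r a c b != 0 -> exists f : nat -> 'I_n,
  [/\ f 0%N = a, f r = c, f r.+1 = b,
      forall i, (i <= r)%N -> g (f i, f i.+1) &
      forall i, (i < r)%N -> f i != f i.+2].
Proof.
elim: r c b => [|r IH] c b /=.
  have [<-|_] := eqVneq a c; last by rewrite mul0r eqxx.
  rewrite mul1r mxE; have [gab _|_ /negP[]//] := boolP (g (a, b)).
  by exists (fun i => if i == 0%N then a else b); split => // -[].
rewrite mulf_eq0 negb_or mxE => /andP[gcb].
have {gcb} gcb : g (c, b) by move: gcb; case: (g _) => // /negP[]; exact: eqxx.
case: (pickP [pred e | (e != b) && (nb_last r a e c != 0)]) => [e /andP[eb]|no].
  case/IH => f [f0 fr fr1 fe fn] _.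
  exists (fun i => if (i <= r.+1)%N then f i else b); split => //; rewrite /= ?leqnn ?ltnn //.
  - move=> i; case: (ltngtP i r.+1) => // [ir|->] _; first by apply: fe.
    by rewrite fr1.
  - move=> i; rewrite ltnS; case: (ltngtP i r) => // [ir|->] _.
      by rewrite (leq_trans (ltnW ir)) ?leqnSn ?ltnS ?ir //= fn.
    by rewrite leqnSn ltnn fr.
rewrite big1 ?eqxx // => e eb; have := no e; rewrite /= eb /=.
by move/negbFE/eqP.
Qed.

(* A repetition f i = f j with j - i minimal bounds a simple cycle; it has
   length at least 3 because the walk does not backtrack. *)
Lemma closed_walk_cycle (f : nat -> 'I_n) r : f 0%N = f r.+1 ->
  (forall i, (i <= r)%N -> g (f i, f i.+1)) ->
  (forall i, (i < r)%N -> f i != f i.+2) ->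
  exists i k, [/\ (i <= r)%N, (2 <= k <= r)%N & f i \in on_cycle k g].
Proof.
move=> f0 fe fn.
pose rep m := (0 < m)%N && [exists i : 'I_r.+1, (i + m <= r.+1)%N && (f i == f (i + m)%N)].
have ex : exists m, rep m.
  by exists r.+1; apply/andP; split => //; apply/existsP; exists ord0; rewrite /= add0n leqnn f0 eqxx.
case: (ex_minnP ex) => m /andP[m0 /existsP[[i ir] /= /andP[im /eqP fim]]] min.
have inj : {in iota i m &, injective f}.
  have lt x y : (x < y)%N -> x \in iota i m -> y \in iota i m -> f x <> f y.
    rewrite !mem_iota => xy /andP[ix xm] /andP[iy ym] fxy.
    have xr : (x < r.+1)%N by lia.
    have : rep (y - x)%N.
      apply/andP; split; first by rewrite subn_gt0.
      by apply/existsP; exists (Ordinal xr); rewrite /= subnKC ?(ltnW xy) // fxy eqxx andbT; lia.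
    by move/min; lia.
  move=> x y xi yi fxy; case: (ltngtP x y) => // xy.
    by case: (lt _ _ xy xi yi).
  by case: (lt _ _ xy yi xi).
case: m m0 im fim min inj => [//|[|[|k]]] _ im fim _ inj.
- have := fe i; rewrite -addn1 -fim (negbTE (irr _)) => /(_ _)/negP[] //.
- by have := fn i; rewrite -addn2 -fim eqxx => /(_ _)/negP[]; lia.
(* The repetition distance is [k.+3], the number of vertices of the cycle; the index in [on_cycle]
   is one less. *)
exists i, k.+2; split; [lia|lia|].
rewrite inE; apply/existsP.
have sz : size [seq f j | j <- iota i.+1 k.+2] == k.+2 by rewrite size_map size_iota.
exists (Tuple sz); apply/andP; split.
  by change (uniq [seq f j | j <- iota i k.+3]); rewrite map_inj_in_uniq // iota_uniq.
change (path (adj g) (f i) (rcons [seq f j | j <- iota i.+1 k.+2] (f i))).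
rewrite rcons_path.
rewrite (last_map f _ i).
have -> : last i (iota i.+1 k.+2) = (i + k.+2)%N.
  by rewrite -nth_last size_iota nth_iota //; lia.
apply/andP; split; last by have := fe (i + k.+2)%N; rewrite -addnS -fim; apply; lia.
have path_f j l : (j + l <= r.+1)%N -> path (adj g) (f j) [seq f i | i <- iota j.+1 l].
  by elim: l j => //= l IH j jl; rewrite {1}/adj fe ?IH //; lia.
by apply: path_f; lia.
Qed.

Lemma nb_mx_diag_neq0 r a : nb_mx r.+1 a a != 0 ->
  exists x k, [/\ (2 <= k <= r)%N, x \in on_cycle k g & a \in gball g r x].
Proof.
rewrite mxE => h.
have [c] : exists c, nb_last r a c a != 0.
  apply/existsP; apply: contraNT h => /existsPn no; rewrite big1 // => c _.
  by have := no c => /negbNE/eqP.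
case/nb_last_walk => f [f0 _ fr fe fn].
have [i [k [ir kr cyc]]] := closed_walk_cycle (etrans f0 (esym fr)) fe fn.
exists (f i), k; split => //; apply: (gball_sym sym); rewrite -f0.
apply: (gball_leq ir); elim: i {cyc} ir => [|i IH] ir; first exact: gball_refl.
rewrite -add1n; apply: gballD (IH (ltnW ir)) _; apply: gball_step.
by apply: fe; exact: ltnW.
Qed.

(** Of the exponent [2 * L], one half pays for the balls around short cycles and the other for the
    bound [d ^ r] on a diagonal entry. *)
Definition few_cycles L :=
  forall k, (2 <= k <= L)%N -> (#|on_cycle k g| * d.+1 ^ (2 * L) <= n)%N.

(** Only vertices close to a short cycle contribute to the trace. For each cycle index [k], their
    number times the bound on a diagonal entry is at most [n], since the exponents add up to
    [2 * r + 1] with [r.+1 <= L]. *)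
Lemma trace_nb_mx_le L r : few_cycles L -> (0 < r <= L)%N ->
  \tr (nb_mx r) <= (r * n)%:R.
Proof.
case: r => // r few /andP[_ rL].
pose bad : {set 'I_n} :=
  (\bigcup_(k < r.+1 | (1 < k)%N) \bigcup_(x in on_cycle k g) gball g r x)%SET.
have cbad : (#|bad| * d.+1 ^ r.+1 <= r.+1 * n)%N.
  apply: leq_trans (leq_mul (leq_card_bigcup _ _) (leqnn _)) _.
  rewrite big_distrl /= big_mkcond.
  have -> : (r.+1 * n = \sum_(k < r.+1) n)%N by rewrite sum_nat_const card_ord.
  apply: leq_sum => k _; case: ifP => // k2.
  apply: leq_trans (few k _); last by rewrite k2 (leq_trans _ rL) // ltnW.
  apply: (@leq_trans (#|on_cycle k g| * d.+1 ^ r * d.+1 ^ r.+1)).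
    rewrite leq_mul2r; apply/orP; right; apply: leq_trans (leq_card_bigcup _ _) _.
    by rewrite -sum_nat_const; apply: leq_sum => x _; exact: card_gball.
  by rewrite -mulnA -expnD leq_mul2l leq_pexp2l ?orbT //; lia.
apply: (@le_trans _ _ (\sum_(a in bad) (d.+1 ^ r.+1)%:R)); last first.
  by rewrite sumr_const -mulrnA mulnC ler_nat.
rewrite /mxtrace (bigID (mem bad)) /= [X in _ + X]big1 ?addr0; last first.
  move=> a; apply: contraNeq => /nb_mx_diag_neq0[x [k [/andP[k2 kr] xk ax]]].
  apply/finset.bigcupP; exists (Ordinal (kr : (k < r.+1)%N)) => //.
  by apply/finset.bigcupP; exists x.
apply: ler_sum => a _; apply: le_trans (nb_mx_diag_le r.+1 a) _.
by rewrite natrX lerXn2r ?nnegrE ?ler0n // ler_nat.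
Qed.

End Regular.

(** Chebyshev polynomials of the second kind, rescaled: [scheb 1 r] is the polynomial [S_r], and
    [scheb (s ^+ 2) r] at [s * x] is [s ^+ r] times [S_r] at [x]. With parameter [q] no square root
    enters the matrix recursion. *)
Fixpoint scheb (F : comNzRingType) (s : F) r : {poly F} :=
  match r with
  | 0 => 1
  | 1 => 'X
  | (r''.+1 as r').+1 => scheb s r' * 'X - s *: scheb s r''
  end.

Lemma schebSS (F : comNzRingType) (s : F) r :
  scheb s r.+2 = scheb s r.+1 * 'X - s *: scheb s r.
Proof. by []. Qed.

End NonBacktracking.

(** * Traces of Chebyshev polynomials of the adjacency matrix *)

Section ChebyshevTrace.
Variables (R : realType) (n q : nat) (g : graph n.+1).
Hypothesis rg : regular_graph q.+1 g.
Local Notation A := (adjmx R g).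

Lemma scheb_nb_mx r : horner_mx A (scheb q%:R r.+2) =
  nb_mx R g r.+2 + horner_mx A (scheb q%:R r).
Proof.
pose W r := horner_mx A (scheb q%:R r).
have W0 : W 0%N = 1%:M by rewrite /W /= rmorph1.
have W1 : W 1%N = A by rewrite /W /= horner_mx_X.
have WS k : W k.+2 = W k.+1 *m A - q%:R *: W k.
  by rewrite /W schebSS rmorphB rmorphM /= horner_mx_X linearZ.
have q1 : q.+1%:R - 1 = q%:R :> R by rewrite -natr1 addrK.
suff H k : W k.+2 = nb_mx R g k.+2 + W k /\ W k.+3 = nb_mx R g k.+3 + W k.+1.
  by case: (H r).
(* The polynomial subtracts [q], the walks subtract [q + 1]; the discrepancy is the identity matrix
   [W 0]. *)
have H0 : W 2%N = nb_mx R g 2 + W 0%N.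
  rewrite WS W1 W0 (nb_mx2 R rg) -addrA; congr (_ + _).
  by rewrite scalemx1 -q1 raddfB /= opprB addrC.
elim: k => [|k [IH1 IH2]].
  split=> //; rewrite WS H0 W1 W0 (nb_mxSSS R rg) nb_mx1 // q1 mulmxDl mul1mx.
  by rewrite addrAC.
split=> //; rewrite [LHS]WS IH2 {1}IH1 (WS k) (nb_mxSSS R rg k.+1) q1.
by rewrite mulmxDl scalerDr opprD addrACA.
Qed.

(** Summing the bounds for lengths [r], [r - 2], ... leaves a constant independent of [q], so
    division by [q^(r/2)] will send the normalized trace to 0 for [r > 0]. Nonnegativity comes from
    the entries being counts. *)
Lemma trace_scheb_bounds L r : few_cycles g q.+1 L -> (r <= L)%N ->
  0 <= \tr (horner_mx A (scheb q%:R r)) <= ((r.+1 ^ 2) * n.+1)%:R.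
Proof.
move=> few; elim/ltn_ind: r => r IH rL.
have ge0 k : 0 <= \tr (nb_mx R g k) by apply: sumr_ge0 => a _; exact: nb_mx_ge0.
case: r IH rL => [|[|r]] IH rL.
- by rewrite /= rmorph1 mxtrace1 ler0n ler_nat mul1n /=.
- rewrite /= horner_mx_X -nb_mx1 // ge0 andTb; apply: le_trans (@trace_nb_mx_le R _ _ _ rg L 1 few rL) _.
  by rewrite ler_nat leq_mul2r orbT.
rewrite scheb_nb_mx mxtraceD; have /andP[h1 h2] := IH r (leqnSn _) (ltnW (ltnW rL)).
rewrite (addr_ge0 (ge0 _) h1) andTb.
  apply: le_trans (lerD (@trace_nb_mx_le R _ _ _ rg L r.+2 few rL) h2) _.
by rewrite -natrD ler_nat -mulnDl leq_mul2r; apply/orP; right; nia.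
Qed.
End ChebyshevTrace.

(** * The spectrum of a regular graph *)

Section Spectrum.
Variable R : realType.

Lemma char_poly_similar (F : fieldType) n (P B : 'M[F]_n) : P \in unitmx ->
  char_poly (invmx P *m B *m P) = char_poly B.
Proof.
move=> uP; pose Q := map_mx (@polyC F) P.
have uQ : Q \in unitmx.
  by rewrite unitmxE det_map_mx rmorph_unit // -unitmxE.
rewrite /char_poly.
have -> : char_poly_mx (invmx P *m B *m P) = invmx Q *m char_poly_mx B *m Q.
  rewrite /char_poly_mx !map_mxM /= mulmxBr mulmxBl -scalemx1 -scalemxAr mulmx1.
  rewrite -scalemxAl mulVmx // scalemx1 /Q; congr (_ - _ *m _ *m _).
  exact: map_invmx.
by rewrite !det_mulmx mulrAC -det_mulmx mulVmx // det1 mul1r.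
Qed.

(** The complexified matrix is Hermitian, so it is unitarily diagonalizable with real eigenvalues;
    the characteristic polynomial and the traces are pulled back along the injection of the
    reals. *)
Lemma real_symmetric_spectrum n (A : 'M[R]_n.+1) : A^T = A ->
  exists l : seq R, [/\ size l = n.+1, char_poly A = \prod_(x <- l) ('X - x%:P) &
    forall p, \tr (horner_mx A p) = \sum_(x <- l) p.[x]].
Proof.
move=> symA; pose toC := real_complex R.
pose B : 'M[R[i]]_n.+1 := map_mx toC A.
have hB : B \is hermsymmx.
  apply: realsym_hermsym.
    apply/is_hermitianmxP; rewrite expr0 scale1r map_mx_id //.
    by apply/matrixP => i j; rewrite !mxE -[in LHS]symA mxE.
  by apply/mxOverP => i j; rewrite mxE; apply/complex_realP; exists (A i j).
have /orthomx_spectralP := hermitian_normalmx hB.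
have /mxOverP := hermitian_spectral_diag_real hB.
have := spectral_unit B.
move: (spectralmx B) (spectral_diag B) => P D uP Dreal BE.
pose d i := complex.Re (D 0 i).
have DE : D = map_mx toC (\row_i d i).
  apply/matrixP => i j; rewrite ord1 !mxE; apply/esym; exact/RRe_real/Dreal.
exists [seq d i | i <- enum 'I_n.+1]; split.
- by rewrite size_map size_enum_ord.
- apply: (map_poly_inj toC); rewrite map_char_poly -/B BE char_poly_similar //.
  rewrite char_poly_trig; last exact/diag_mx_is_trig.
  rewrite big_map big_enum /= map_prod_XsubC.
  by apply: eq_bigr => i _; rewrite DE !mxE eqxx mulr1n.
move=> p; apply: (@complexI R); rewrite -/toC.
transitivity (\tr (map_mx toC (horner_mx A p))).
  by rewrite [LHS]rmorph_sum; apply: eq_bigr => i _; rewrite mxE.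
rewrite map_horner_mx -/B BE.
rewrite horner_mx_uconjC // mxtrace_mulC mulmxA mulmxV // mul1mx horner_mx_diag.
rewrite mxtrace_diag big_map big_enum [RHS]rmorph_sum /=.
by apply: eq_bigr => i _; rewrite DE !mxE horner_map.
Qed.

Lemma sum_count_mem_undup (T : eqType) (l : seq T) (P : pred T) :
  (\sum_(x <- undup l | P x) count_mem x l = count P l)%N.
Proof.
rewrite -sum1_count -(big_undup_iterop_count _ l P (fun=> 1%N)).
apply: eq_bigr => x _; rewrite Monoid.iteropE.
by elim: (count_mem x l) => //= k <-.
Qed.

Definition empirical (s : seq R) (B : set R) : \bar R :=
  ((count (mem B) s)%:R / (size s)%:R)%:E.

(** Grouping equal entries of the list of eigenvalues turns root multiplicities into counts. *)
Lemma spectral_measureE q n (g : graph n) (l : seq R) : size l = n ->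
  char_poly (adjmx R g) = \prod_(x <- l) ('X - x%:P) ->
  @spectral_measure R q n g = empirical [seq x / Num.sqrt q%:R | x <- l].
Proof.
move=> sl chE; apply/funext => B; rewrite /spectral_measure /empirical size_map sl.
congr ((_ / _)%:E); rewrite count_map.
set P := preim _ _.
transitivity (\sum_(x <- [seq x <- undup l | P x]) (mup x (char_poly (adjmx R g)))%:R : R).
  have -> : [set x | root (char_poly (adjmx R g)) x] `&` ((fun y => y / Num.sqrt q%:R) @^-1` B) = [set` [seq x <- undup l | P x]].
    apply/seteqP; split => x /=.
      rewrite chE root_prod_XsubC => -[xl Bx].
      by rewrite mem_filter mem_undup xl andbT /P /= inE.
    rewrite mem_filter mem_undup chE root_prod_XsubC => /andP[].
    by rewrite /P /= inE.
  by rewrite -fsbig_seq ?filter_uniq ?undup_uniq.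
rewrite big_filter -sum_count_mem_undup natr_sum; apply: eq_bigr => x _.
by rewrite chE mu_prod_XsubC.
Qed.

Lemma scheb_scale (s x : R) r :
  (scheb (s ^+ 2) r).[s * x] = s ^+ r * (scheb 1 r).[x].
Proof.
suff: (scheb (s ^+ 2) r).[s * x] = s ^+ r * (scheb 1 r).[x] /\
      (scheb (s ^+ 2) r.+1).[s * x] = s ^+ r.+1 * (scheb 1 r.+1).[x] by case.
elim: r => [|r [IH1 IH2]]; first by rewrite /= !hornerE ?expr0 ?mul1r ?expr1.
split=> //; rewrite !schebSS !(hornerD, hornerN, hornerM, hornerX, hornerZ) IH1 IH2 !exprS; ring.
Qed.

End Spectrum.

(** * Couplings with a discrete measure *)

Section TransportFromCells.
Variables (R : realType) (nu : probability R R) (n : nat).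
Variables (cell : nat -> set R) (x : nat -> R).
Hypothesis n_gt0 : (0 < n)%N.
Hypothesis cell_meas : forall i, measurable (cell i).
Hypothesis cell_triv : trivIset setT cell.
Hypothesis cell_mass : forall i, (i < n)%N -> nu (cell i) = (n%:R^-1)%:E.

Let cells := \big[setU/set0]_(i <- iota 0 n) cell i.

Let cells_meas : measurable cells.
Proof. by apply: bigsetU_measurable. Qed.

Let triv : trivIset [set` iota 0 n] cell.
Proof. exact: sub_trivIset cell_triv. Qed.

Let cells_full : nu (~` cells) = 0%E.
Proof.
rewrite probability_setC // (_ : nu cells = 1%E) ?subee //.
have -> : nu cells = (\int[nu]_(y in cells) (cst 1%E) y)%E.
  by rewrite integral_cst // mul1e.
rewrite (ge0_integral_bigsetU nu cell_meas (iota_uniq _ _) triv) //.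
rewrite big_seq (eq_bigr (fun=> (n%:R^-1)%:E)) => [|i].
  rewrite -big_seq sumEFin big_const_seq count_predT size_iota iter_addr_0.
  rewrite -[X in X%:E]mulr_natr mulVf //.
  by rewrite pnatr_eq0 -lt0n.
by rewrite mem_iota => /andP[_ ilt]; rewrite integral_cst // mul1e; exact: cell_mass.
Qed.

Lemma ge0_integral_cells (f : R -> \bar R) : measurable_fun [set: R] f ->
  (forall y, 0 <= f y)%E ->
  (\int[nu]_y f y = \sum_(i <- iota 0 n) \int[nu]_(y in cell i) f y)%E.
Proof.
move=> mf f0; rewrite (ge0_negligible_integral (measurableC cells_meas)) //.
rewrite setTD setCK (ge0_integral_bigsetU nu cell_meas (iota_uniq _ _) triv) //.
exact: measurable_funTS.
Qed.

(** Piecewise constant with value [x i] on cell [i]. Cells of equal mass make its image measure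
    uniform on the listed points; the coupling is the law of [(transport y, y)] under [nu]. *)
Definition transport (y : R) : R := \sum_(i <- iota 0 n) x i * \1_(cell i) y.

Lemma transport_cell i y : (i < n)%N -> cell i y -> transport y = x i.
Proof.
move=> ilt cy; rewrite /transport (bigD1_seq i) ?mem_iota ?iota_uniq //=.
rewrite indicE mem_set // mulr1 big1 ?addr0 // => j ji.
rewrite indicE memNset ?mulr0 // => cjy; move/negP: ji; apply; apply/eqP.
by apply: (cell_triv I I); exists y.
Qed.

Lemma transport_measurable : measurable_fun [set: R] transport.
Proof.
apply: measurable_sum => i; apply: measurable_funM; first exact: measurable_cst.
exact: measurable_indic.
Qed.

Let graph_map (y : R) : (R * R)%type :=
  (transport y, y).

Let graph_map_measurable : measurable_fun [set: R] graph_map.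
Proof.
by apply: measurable_fun_pair; [exact: transport_measurable|exact: measurable_id].
Qed.

HB.instance Definition _ := isMeasurableFun.Build _ _ _ _ graph_map graph_map_measurable.

Definition transport_plan : probability (R * R)%type R :=
  distribution nu graph_map.

Lemma transport_plan_coupling :
  coupling (empirical [seq x i | i <- iota 0 n]) nu transport_plan.
Proof.
move=> A mA; split; last first.
  rewrite /transport_plan /distribution /pushforward; congr (nu _).
  by apply/seteqP; split => y //= [].
have -> : transport_plan (A `*` setT) = nu (transport @^-1` A).
  rewrite /transport_plan /= /distribution /pushforward; congr (nu _).
  by apply/seteqP; split => y //= [].
have mTA : measurable (transport @^-1` A).
  by rewrite -[X in measurable X]setTI; exact: transport_measurable.
have -> : nu (transport @^-1` A) = (\int[nu]_y (\1_(transport @^-1` A) y)%:E)%E.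
  by rewrite integral_indic // setIT.
rewrite ge0_integral_cells; last 2 first.
- exact/measurable_EFinP/measurable_indic.
- by move=> y; rewrite lee_fin.
rewrite /empirical size_map size_iota count_map -sum1_count natr_sum mulr_suml -sumEFin.
rewrite big_seq [RHS]big_mkcond [RHS]big_seq; apply: eq_bigr => i.
rewrite mem_iota => /andP[_ ilt]; rewrite integral_indic // mul1r /=.
case: ifPn => [|] xA.
  rewrite -(cell_mass ilt); congr (nu _); apply/seteqP; split => y /=; first by case.
  by move=> cy; split => //; rewrite /= (transport_cell ilt cy); rewrite inE in xA.
rewrite (_ : _ `&` _ = set0) ?measure0 //; apply/seteqP; split => y //= [].
move=> + cy; rewrite (transport_cell ilt cy) => xA'.
by move/negP: xA; apply; rewrite inE.
Qed.

Lemma transport_plan_cost (p : R) (h : nat -> R) : (forall i, 0 <= h i) ->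
  (forall i y, (i < n)%N -> cell i y -> `|x i - y| `^ p <= h i) ->
  (\int[transport_plan]_(z in setT) (`|z.1 - z.2| `^ p)%:E <=
   ((\sum_(i <- iota 0 n) h i) / n%:R)%:E)%E.
Proof.
move=> h0 hx.
have mcost : measurable_fun [set: R * R] (fun z : R * R => (`|z.1 - z.2| `^ p)%:E).
  apply/measurable_EFinP; apply: (measurableT_comp (measurable_powR p)).
  apply: measurableT_comp => //; apply: measurable_funB; [exact: measurable_fst|exact: measurable_snd].
rewrite ge0_integral_distribution //.
rewrite ge0_integral_cells; last 2 first.
- exact: measurableT_comp mcost graph_map_measurable.
- by move=> y /=; rewrite lee_fin powR_ge0.
rewrite mulr_suml -sumEFin big_seq [leRHS]big_seq; apply: lee_sum => i.
rewrite mem_iota => /andP[_ ilt]; rewrite EFinM -(cell_mass ilt) -integral_cst //.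
have mint : measurable_fun (cell i) ((fun z : R * R => (`|z.1 - z.2| `^ p)%:E) \o graph_map).
  by apply: measurable_funTS; exact: measurableT_comp mcost graph_map_measurable.
apply: ge0_le_integral => // y cy; rewrite lee_fin //.
by rewrite /= (transport_cell ilt cy) hx.
Qed.

End TransportFromCells.

(** * The semicircle law *)

Section Semicircle.
Variable R : realType.
Implicit Types (x a b : R) (p : {poly R}).
Local Notation mu := (@lebesgue_measure R).

Definition half_circle x : R := Num.sqrt (4 - x ^+ 2).
Local Notation w := half_circle.

Definition sc_density x : R := (2 * pi)^-1 * w x.

(* 2 atan (x / (2 + w x)) = asin (x / 2), in a form that stays continuous up
   to the end points. *)
Definition sc_cdf x : R :=
  2^-1 + (2 * pi)^-1 * (2^-1 * (x * w x) + 4 * atan (x / (2 + w x))).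

Definition support : set R := `[-2, 2].

Lemma half_circle_ge0 x : 0 <= w x. Proof. exact: sqrtr_ge0. Qed.

Lemma half_circle_sq x : -2 <= x <= 2 -> w x ^+ 2 = 4 - x ^+ 2.
Proof. by move=> /andP[h1 h2]; rewrite sqr_sqrtr //; nra. Qed.

Lemma half_circle_gt0 x : -2 < x < 2 -> 0 < w x.
Proof. by move=> /andP[h1 h2]; rewrite sqrtr_gt0; nra. Qed.

Lemma half_circle_out x : x \notin `[-2, 2] -> w x = 0.
Proof.
by rewrite in_itv /= => /negP h; apply: ler0_sqrtr; rewrite leNgt; apply/negP => h'; apply: h; apply/andP; split; nra.
Qed.

Lemma half_circle_end : w 2 = 0 /\ w (-2) = 0.
Proof.
have e : 4 - 2 ^+ 2 = 0 :> R by ring.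
by rewrite /half_circle sqrrN e sqrtr0.
Qed.

Lemma continuous_half_circle : continuous w.
Proof.
move=> x; apply: (@continuous_comp _ _ _ (fun x : R => 4 - x ^+ 2) Num.sqrt); last exact: sqrt_continuous.
by apply: cvgB; [exact: cvg_cst|exact: exprn_continuous].
Qed.

Lemma sc_density_ge0 x : 0 <= sc_density x.
Proof. by rewrite mulr_ge0 ?half_circle_ge0 // invr_ge0 mulr_ge0 ?pi_ge0. Qed.

Lemma continuous_sc_density : continuous sc_density.
Proof. by move=> x; apply: cvgM; [exact: cvg_cst|exact: continuous_half_circle]. Qed.

Lemma is_derive_half_circle x : -2 < x < 2 -> is_derive x 1 w (- x / w x).
Proof.
move=> xx; have w0 := half_circle_gt0 xx.
have d0 : 0 < 4 - x ^+ 2 by move: xx => /andP[h1 h2]; nra.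
have D1 : is_derive x 1 (fun x : R => 4 - x ^+ 2) (- (2 * x)).
  by apply: is_derive_eq; rewrite /GRing.scale /=; ring.
have := @is_derive1_comp R (fun x : R => Num.sqrt x) (fun x : R => 4 - x ^+ 2) x _ _ (is_derive1_sqrt d0) D1.
move=> D; apply: (is_derive_eq D); rewrite -/(w x); field; lra.
Qed.

(** Inside the interval [w x] is positive, and eliminating [x ^+ 2 = 4 - w x ^+ 2] makes the
    derivative a rational function of [w x]. *)
Lemma is_derive_sc_cdf x : -2 < x < 2 -> is_derive x 1 sc_cdf (sc_density x).
Proof.
move=> xx; have w0 := half_circle_gt0 xx; have Dw := is_derive_half_circle xx.
have wsq : w x ^+ 2 = 4 - x ^+ 2 by apply: half_circle_sq; lra.
have D2 : is_derive x 1 (fun y => 2 + w y) (- x / w x).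
  have D := @is_deriveD R R R (cst 2) w x 1 _ _ (is_derive_cst _ _ _) Dw.
  by apply: (is_derive_eq D); rewrite add0r.
have n0 : 2 + w x != 0 by lra.
have D3 := @is_deriveV R (fun y : R => 2 + w y) x (- x / w x) 1 n0 D2.
have D4 : is_derive x 1 (fun y => y / (2 + w y)) (2 / (w x * (2 + w x))).
  have := @is_deriveM R R (id : R -> R) (fun y => (2 + w y)^-1) x 1 _ _ (is_derive_id _ _) D3.
  move=> D; apply: (is_derive_eq D).
  rewrite /= scaler1 /GRing.scale /=.
  have -> : (2 : R) / (w x * (2 + w x)) = (2 * (2 + w x)) / (w x * (2 + w x) ^+ 2) by field; lra.
  have x2 : x ^+ 2 = 4 - w x ^+ 2 by rewrite wsq; ring.
  have -> : 2 * (2 + w x) / (w x * (2 + w x) ^+ 2) = (w x * (2 + w x) + x ^+ 2) / (w x * (2 + w x) ^+ 2).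
    by rewrite x2; congr (_ / _); ring.
  by field; lra.
have D5 := @is_derive1_comp R (fun x : R => atan x) (fun y => y / (2 + w y)) x _ _ (is_derive1_atan _) D4.
have D6 : is_derive x 1 (fun y => y * w y) (w x - x ^+ 2 / w x).
  have D := @is_deriveM R R (id : R -> R) w x 1 _ _ (is_derive_id _ _) Dw.
  by apply: (is_derive_eq D); rewrite /= scaler1 /GRing.scale /=; field; lra.
have D := is_deriveD (is_derive_cst (2^-1 : R) x 1) (is_deriveZ (2 * pi)^-1
  (is_deriveD (is_deriveZ 2^-1 D6) (is_deriveZ 4 D5))).
apply: (is_derive_eq D); rewrite add0r /GRing.scale /= /sc_density; congr (_ * _).
have den : 1 + (x / (2 + w x)) ^+ 2 = 4 / (2 + w x).
  have x2 : x ^+ 2 = 4 - w x ^+ 2 by rewrite wsq; ring.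
  by rewrite expr_div_n x2; field; lra.
have x2 : x ^+ 2 = 4 - w x ^+ 2 by rewrite wsq; ring.
rewrite den x2.
by field; lra.
Qed.

Lemma continuous_sc_cdf : continuous sc_cdf.
Proof.
move=> x; have cw : w y @[y --> x] --> w x := @continuous_half_circle x.
have c1 : y / (2 + w y) @[y --> x] --> x / (2 + w x).
  apply: cvgM; first exact: cvg_id.
  apply: cvgV; last by apply: cvgD; [exact: cvg_cst|exact: cw].
  by have := half_circle_ge0 x; lra.
have c2 : atan (y / (2 + w y)) @[y --> x] --> atan (x / (2 + w x)).
  by apply: (cvg_comp _ _ c1); exact: continuous_atan.
apply: cvgD; first exact: cvg_cst.
apply: cvgM; first exact: cvg_cst.
apply: cvgD; apply: cvgM; [exact: cvg_cst| |exact: cvg_cst|exact: c2].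
by apply: cvgM; [exact: cvg_id|exact: cw].
Qed.

Lemma sc_cdf_end : sc_cdf 2 = 1 /\ sc_cdf (-2) = 0.
Proof.
have [w2 wN2] := half_circle_end.
have p0 : (pi : R) != 0 by rewrite gt_eqF // pi_gt0.
rewrite /sc_cdf w2 wN2 !mulr0 !addr0 mulNr divff // atanN atan1.
by move: (pi : R) p0 => c c0; split; field.
Qed.

Lemma integral_sc_density a b : -2 <= a -> a < b -> b <= 2 ->
  (\int[mu]_(x in `[a, b]) (sc_density x)%:E = (sc_cdf b - sc_cdf a)%:E)%E.
Proof.
move=> a2 ab b2; rewrite EFinB; apply: continuous_FTC2 => //.
- by apply: continuous_subspaceT; exact: continuous_sc_density.
- split.
  + move=> x; rewrite in_itv /= => /andP[ax xb].
    by have [] : is_derive x 1 sc_cdf (sc_density x) by apply: is_derive_sc_cdf; lra.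
  + by apply: cvg_at_right_filter; exact: continuous_sc_cdf.
  + by apply: cvg_at_left_filter; exact: continuous_sc_cdf.
- move=> x; rewrite in_itv /= => /andP[ax xb].
  have D : is_derive x 1 sc_cdf (sc_density x) by apply: is_derive_sc_cdf; lra.
  by rewrite derive1E derive_val.
Qed.

Lemma sc_cdf_ler a b : -2 <= a -> a <= b -> b <= 2 -> sc_cdf a <= sc_cdf b.
Proof.
move=> a2; rewrite le_eqVlt => /orP[/eqP -> //|ab] b2.
rewrite -subr_ge0 -lee_fin -integral_sc_density //.
by apply: integral_ge0 => x _; rewrite lee_fin sc_density_ge0.
Qed.

Lemma measurable_sc_density : measurable_fun [set: R] sc_density.
Proof. by apply: continuous_measurable_fun; exact: continuous_sc_density. Qed.

Lemma semicircleE (A : set R) : @semicircle R A =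
  (\int[mu]_(x in A `&` support) (sc_density x)%:E)%E.
Proof.
rewrite /semicircle; congr (integral _ (_ `&` _) _).
by apply/seteqP; split => x; rewrite /support /= in_itv /= ler_norml.
Qed.

(** The square root of a negative number is 0 by convention, so the density already vanishes off the
    support. Integrals over arbitrary measurable sets then give countable additivity. *)
Lemma semicircle_density (A : set R) : measurable A -> @semicircle R A =
  (\int[mu]_(x in A) (sc_density x)%:E)%E.
Proof.
move=> mA; rewrite semicircleE integral_mkcondr; apply: eq_integral => x _.
rewrite patchE; case: ifPn => //; rewrite notin_setE /support /= => /negP h.
by rewrite /sc_density half_circle_out ?mulr0.
Qed.

Let semicircle0 : @semicircle R set0 = 0%E.
Proof. by rewrite semicircleE set0I integral_set0. Qed.

Let semicircle_ge0 A : (0 <= @semicircle R A)%E.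
Proof. by rewrite semicircleE; apply: integral_ge0 => x _; rewrite lee_fin sc_density_ge0. Qed.

Let semicircle_sigma_additive : semi_sigma_additive (@semicircle R).
Proof.
move=> F mF tF mUF; rewrite semicircle_density //; apply: cvg_toP.
  apply: ereal_nondecreasing_is_cvgn => m n mn.
  by apply: lee_sum_nneg_natr => // k _ _; exact: semicircle_ge0.
rewrite ge0_integral_bigcup //=.
- by apply: eq_eseriesr => k _; rewrite semicircle_density.
- by apply/measurable_EFinP/measurable_funTS; exact: measurable_sc_density.
- by move=> x _; rewrite lee_fin sc_density_ge0.
Qed.

HB.instance Definition _ := isMeasure.Build _ _ _ (@semicircle R)
  semicircle0 semicircle_ge0 semicircle_sigma_additive.

Let semicircle_setT : @semicircle R setT = 1%E.
Proof.
have [c2 cN2] := sc_cdf_end.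
by rewrite semicircleE setTI /support integral_sc_density // ?c2 ?cN2 ?subr0 //; lra.
Qed.

HB.instance Definition _ := @Measure_isProbability.Build _ _ R
  (@semicircle R) semicircle_setT.

Lemma semicircle_itv a b : -2 <= a -> a <= b -> b <= 2 ->
  @semicircle R `[a, b[ = (sc_cdf b - sc_cdf a)%:E.
Proof.
move=> a2; rewrite le_eqVlt => /orP[/eqP ->|ab] b2.
  by rewrite set_itv_ge ?measure0 ?subrr // bnd_simp ltxx.
rewrite semicircle_density // integral_itv_bndo_bndc ?integral_sc_density //.
by apply/measurable_EFinP/measurable_funTS; exact: measurable_sc_density.
Qed.

End Semicircle.

(** * Semicircle means of polynomials *)

Section SemicircleMoments.
Variable R : realType.
Implicit Types (x a b : R) (p : {poly R}).
Local Notation mu := (@lebesgue_measure R).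

Definition sc_mean p : R := (\int[mu]_(x in @support R) (p.[x] * sc_density x))%R.

Lemma sc_integrable p a b :
  mu.-integrable `[a, b] (EFin \o (fun x : R => p.[x] * sc_density x)).
Proof.
apply: continuous_compact_integrable; first exact: segment_compact.
apply: continuous_subspaceT => x; apply: cvgM; first exact: continuous_horner.
exact: continuous_sc_density.
Qed.

Lemma measurable_support : measurable (@support R).
Proof. exact: measurable_itv. Qed.

Lemma sc_meanD p p' : sc_mean (p + p') = sc_mean p + sc_mean p'.
Proof.
rewrite /sc_mean -RintegralD; last 3 first.
- exact: measurable_support.
- exact: sc_integrable.
- exact: sc_integrable.
by apply: eq_Rintegral => x _; rewrite hornerD mulrDl.
Qed.

Lemma sc_meanZ (c : R) p : sc_mean (c *: p) = c * sc_mean p.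
Proof.
rewrite /sc_mean -RintegralZl; last 2 first.
- exact: measurable_support.
- exact: sc_integrable.
by apply: eq_Rintegral => x _ /=; rewrite hornerZ -mulrA.
Qed.

Lemma sc_mean1 : sc_mean 1 = 1.
Proof.
have [c2 cN2] := sc_cdf_end R.
transitivity (\int[mu]_(x in @support R) sc_density x).
  by apply: eq_Rintegral => x _; rewrite hornerC mul1r.
by rewrite /Rintegral /support integral_sc_density ?c2 ?cN2 ?subr0 //; lra.
Qed.

(** With [x = 2 cos t], the bracket [2 S_(r+1) - x S_r] is [2 cos((r+1)t)], and the identity is the
    derivative of [sin((r+1)t) / sin t] with respect to [x]. *)
Lemma scheb_ode r : (4%:P - 'X^2) * (scheb (1 : R) r)^`() =
  'X * scheb 1 r - r.+1%:R%:P * (2%:P * scheb 1 r.+1 - 'X * scheb 1 r).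
Proof.
suff: (4%:P - 'X^2) * (scheb (1 : R) r)^`() =
    'X * scheb 1 r - r.+1%:R%:P * (2%:P * scheb 1 r.+1 - 'X * scheb 1 r) /\
  (4%:P - 'X^2) * (scheb (1 : R) r.+1)^`() =
    'X * scheb 1 r.+1 - r.+2%:R%:P * (2%:P * scheb 1 r.+2 - 'X * scheb 1 r.+1) by case.
elim: r => [|r [IH1 IH2]].
  rewrite schebSS /= derivC derivX scale1r.
  by split; rewrite !polyC_natr; ring.
split=> //.
have E k : scheb (1 : R) k.+2 = scheb 1 k.+1 * 'X - scheb 1 k by rewrite schebSS scale1r.
have dE : (scheb (1 : R) r.+2)^`() =
    (scheb 1 r.+1)^`() * 'X + scheb 1 r.+1 - (scheb 1 r)^`().
  by rewrite E derivB derivM derivX mulr1.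
rewrite dE mulrBr mulrDr mulrA IH1 IH2 (E r.+1) (E r).
move: (scheb 1 r.+1) (scheb 1 r) => s t.
rewrite !polyC_natr -[r.+3%:R]natr1 -[r.+2%:R]natr1 -[r.+1%:R]natr1.
by move: (r%:R : {poly R}) => c; ring.
Qed.

Lemma sc_mean_scheb r : sc_mean (scheb 1 r.+1) = 0.
Proof.
(* Under [x = 2 cos t] the integrand becomes a multiple of [sin((r+2)t) sin t]. Writing this as a
   difference of cosines and integrating gives the antiderivative [P] times [half_circle], which
   vanishes at both end points. *)
pose P : {poly R} := r.+3%:R^-1 *: scheb 1 r.+2 - r.+1%:R^-1 *: scheb 1 r.
(* This is the derivative of that product, multiplied by [half_circle x] to clear the
   denominator. *)
have Pode x : (4 - x ^+ 2) * P^`().[x] - x * P.[x] = (4 - x ^+ 2) * (scheb 1 r.+1).[x].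
  have h k : (4 - x ^+ 2) * (scheb (1 : R) k)^`().[x] = x * (scheb 1 k).[x] -
      k.+1%:R * (2 * (scheb 1 k.+1).[x] - x * (scheb 1 k).[x]).
    have := congr1 (horner^~ x) (scheb_ode k).
    by rewrite !(hornerD, hornerN, hornerM, hornerC, hornerXn, hornerX).
  have E k : (scheb (1 : R) k.+2).[x] = (scheb 1 k.+1).[x] * x - (scheb 1 k).[x].
    by rewrite schebSS scale1r !(hornerD, hornerN, hornerM, hornerX).
  rewrite /P; move: (h r.+2) (h r) (E r.+1) (E r).
  move: (scheb 1 r.+3) (scheb 1 r.+2) (scheb 1 r.+1) (scheb 1 r) => S3 S2 S1 S0 h2 h0 e3 e2.
  rewrite derivB !derivZ !(hornerD, hornerN, hornerZ) mulrBr.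
  rewrite mulrCA [X in _ - X - _]mulrCA h2 h0 e3 e2.
  move: S1.[x] S0.[x] => s t.
  have n1 : r.+1%:R != 0 :> R by rewrite pnatr_eq0.
  have n3 : r.+3%:R != 0 :> R by rewrite pnatr_eq0.
  move: (r.+1%:R : R) (r.+3%:R : R) n1 n3 => c1 c3 n1 n3.
  by field; rewrite n1 n3.
have D x : -2 < x < 2 -> is_derive x 1 (fun y => P.[y] * half_circle y)
    ((scheb 1 r.+1).[x] * half_circle x).
  move=> xx; have Dw := is_derive_half_circle xx.
  have D := @is_deriveM R R (horner P) (@half_circle R) x 1 _ _ (is_derive_poly P x) Dw.
  have w0 := half_circle_gt0 xx.
  have wsq : half_circle x ^+ 2 = 4 - x ^+ 2 by apply: half_circle_sq; lra.
  apply: (is_derive_eq D); rewrite /GRing.scale /=.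
  have := Pode x; rewrite -wsq.
  move: (half_circle x) w0 P.[x] P^`().[x] (scheb 1 r.+1).[x] => w w0 a b c h.
  have wn : w != 0 by lra.
  apply: (mulfI wn); have -> : w * (c * w) = w ^+ 2 * c by ring.
  by rewrite -h; field; rewrite ?wn.
have [w2 wN2] := half_circle_end R.
have FTC : (\int[mu]_(x in `[(-2 : R)%R, 2%R]) ((scheb 1 r.+1).[x] * half_circle x)%:E = 0%:E)%E.
  have cF : continuous (fun y : R => P.[y] * half_circle y).
    by move=> y; apply: cvgM; [exact: continuous_horner|exact: continuous_half_circle].
  rewrite (@continuous_FTC2 _ _ (fun y => P.[y] * half_circle y)) //.
  - by rewrite w2 wN2 !mulr0 subee.
  - by lra.
  - apply: continuous_subspaceT => y; apply: cvgM; first exact: continuous_horner.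
    exact: continuous_half_circle.
  - split.
    + by move=> x; rewrite in_itv /= => xx; have [] := D _ xx.
    + by apply: cvg_at_right_filter; exact: cF.
    + by apply: cvg_at_left_filter; exact: cF.
  - move=> x; rewrite in_itv /= => xx; have Dx := D _ xx.
    by rewrite derive1E derive_val.
transitivity (\int[mu]_(x in @support R) ((2 * pi)^-1 * ((scheb 1 r.+1).[x] * half_circle x))).
  by apply: eq_Rintegral => x _; rewrite /sc_density mulrCA.
rewrite RintegralZl /support; [|exact: measurable_itv|].
  by rewrite /Rintegral FTC mulr0.
apply: continuous_compact_integrable; first exact: segment_compact.
apply: continuous_subspaceT => x; apply: cvgM; first exact: continuous_horner.
exact: continuous_half_circle.
Qed.

Lemma sc_mean_le p (c1 c2 g : R) : -2 <= g <= 2 ->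
  (forall x, -2 <= x <= g -> p.[x] <= c1) ->
  (forall x, g <= x <= 2 -> p.[x] <= c2) ->
  sc_mean p <= c1 * sc_cdf g + c2 * (1 - sc_cdf g).
Proof.
move=> /andP[g1 g2] h1 h2.
have [F2 FN2] := sc_cdf_end R.
have mass a b : -2 <= a -> a <= b -> b <= 2 ->
    \int[mu]_(x in `[a, b]) sc_density x = sc_cdf b - sc_cdf a.
  move=> a2; rewrite le_eqVlt => /orP[/eqP -> _|ab b2].
    by rewrite set_itv1 /Rintegral integral_set1 subrr.
  by rewrite /Rintegral integral_sc_density.
have bound a b c : -2 <= a -> a <= b -> b <= 2 ->
    (forall x, a <= x <= b -> p.[x] <= c) ->
    \int[mu]_(x in `[a, b]) (p.[x] * sc_density x) <= c * (sc_cdf b - sc_cdf a).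
  move=> a2 ab b2 pc; rewrite -(mass a b a2 ab b2) -RintegralZl; last 2 first.
  - exact: measurable_itv.
  - have := sc_integrable 1 a b; congr (mu.-integrable _ _).
    by apply/funext => x /=; rewrite hornerC mul1r.
  apply: le_Rintegral; first exact: measurable_itv.
  - exact: sc_integrable.
  - have := sc_integrable c%:P a b; congr (mu.-integrable _ _).
    by apply/funext => x /=; rewrite hornerC.
  - move=> x; rewrite /= in_itv /= => xab.
    by apply: ler_wpM2r; [exact: sc_density_ge0|exact: pc].
have split_g : sc_mean p = \int[mu]_(x in `[-2, g]) (p.[x] * sc_density x) +
    \int[mu]_(x in `[g, 2]) (p.[x] * sc_density x).
  have := @Rintegral_itvB R (fun x => p.[x] * sc_density x) (BLeft (-2)) (BRight 2) g.
  move=> /(_ (sc_integrable _ _ _)); rewrite !bnd_simp => /(_ g1 g2) h.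
  have := @Rintegral_itv_obnd_cbnd R g (BRight 2) (fun x => p.[x] * sc_density x).
  move=> h'; rewrite -h'; last first.
    apply: (integrableS _ _ _ (sc_integrable p g 2)) => //.
    by apply: subset_itvr; rewrite bnd_simp.
  by rewrite -h /sc_mean /support addrC subrK.
rewrite split_g.
have b1 := bound (-2) g c1 (lexx _) g1 g2 h1.
have b2 := bound g 2 c2 g1 g2 (lexx _) h2.
by rewrite F2 FN2 subr0 in b1 b2; exact: lerD b1 b2.
Qed.

End SemicircleMoments.

(** * Polynomial approximation of half-lines *)

Section StepPolynomials.
Variable R : realType.
Implicit Types (x u e g : R) (p : {poly R}).

Lemma bernoulli_ler u N : 0 <= u <= 1 -> 1 - N%:R * u <= (1 - u) ^+ N.
Proof.
move=> /andP[u0 u1]; elim: N => [|N IH]; first by rewrite mul0r subr0 expr0.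
rewrite exprSr; apply: le_trans (ler_wpM2r _ IH); last by rewrite subr_ge0.
rewrite -natr1; have : 0 <= N%:R :> R by []. nra.
Qed.

(** The stronger product with [1 + N%:R * u] is at most 1 because it does not increase with [N]. *)
Lemma expr_1Bu_le u N : 0 <= u <= 1 -> (1 - u) ^+ N * (N%:R * u) <= 1.
Proof.
move=> /andP[u0 u1].
have h : (1 - u) ^+ N * (1 + N%:R * u) <= 1.
  elim: N => [|N IH]; first by rewrite expr0 mul0r addr0 mulr1.
  apply: le_trans _ IH; rewrite exprSr -mulrA; apply: ler_wpM2l.
    by rewrite exprn_ge0 // subr_ge0.
  rewrite -natr1; have : 0 <= N%:R :> R by []. nra.
apply: le_trans _ h; apply: ler_wpM2l; first by rewrite exprn_ge0 // subr_ge0.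
by rewrite lerDr.
Qed.

Lemma expr_lt_eps (rho d : R) : 0 <= rho < 1 -> 0 < d -> exists m, rho ^+ m.+1 < d.
Proof.
move=> /andP[r0 r1] d0.
have /cvgrPdist_lt/(_ _ d0)[N _ h] : rho ^+ m @[m --> \oo] --> (0 : R).
  by apply: cvg_expr; rewrite ger0_norm.
exists N; have := h N.+1 (leqnSn N).
by rewrite sub0r normrN ger0_norm // exprn_ge0.
Qed.

(* (1 - s^m)^(2^m) tends to 1 for 0 <= s < 1/2 and to 0 for 1/2 < s <= 1; the
   term (x/3)^(2m) takes care of the points outside [-3, 3]. *)
Lemma step_polynomial (sg g e eta : R) : sg = 1 \/ sg = -1 -> -2 <= g <= 2 ->
  0 < e <= 1 -> 0 < eta -> exists Q : {poly R},
  [/\ forall x, 0 <= Q.[x],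
      forall x, e <= sg * (x - g) -> 1 <= Q.[x],
      forall x, -2 <= x <= 2 -> Q.[x] <= 1 + eta &
      forall x, -2 <= x <= 2 -> sg * (x - g) <= 0 -> Q.[x] <= eta].
Proof.
move=> sgE /andP[g1 g2] /andP[e0 e1] eta0.
(* Chosen so that [4 * dl <= eta] and [dl < 1/2], whence [(1 + dl) / (1 - dl) <= 1 + eta]. *)
pose dl := eta / (4 + 2 * eta).
have dn : 0 < 4 + 2 * eta by lra.
have dl0 : 0 < dl by rewrite divr_gt0.
have dl2 : dl < 2^-1 by rewrite ltr_pdivrMr //; lra.
have dleta : 4 * dl <= eta by rewrite mulrA ler_pdivrMr //; nra.
pose rho := 1 - e / 32.
have rho01 : 0 <= rho < 1 by rewrite /rho; apply/andP; split; lra.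
have [m] := expr_lt_eps rho01 dl0; set M := m.+1 => rhoM.
have M2 : (2 ^+ M : R) = (2 ^ M)%N%:R by rewrite natrX.
(* The slope 1/16 keeps [s] in [[0, 1]] on [[-3, 3]]. The shift [e / 32] puts the value 1/2 in the
   middle of the transition zone [0 <= sg * (x - g) <= e], so [2 * s x] stays at distance at least
   [e / 16] from 1 outside it. *)
pose s x : R := 2^-1 - sg * (x - g) / 16 + e / 32.
pose sp : {poly R} := (2^-1 + e / 32)%:P - (sg / 16) *: ('X - g%:P).
have spE x : sp.[x] = s x.
  by rewrite /sp /s !(hornerD, hornerN, hornerZ, hornerC, hornerX); ring.
(* Division by [1 - dl] lifts values close to 1 above 1. The exponent [2 ^ M] is even because [M] is
   positive, which gives nonnegativity on the whole line. *)
pose Q : {poly R} := (1 - dl)^-1 *: ((1 - sp ^+ M) ^+ (2 ^ M) + (9^-1 *: 'X^2) ^+ M).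
have QE x : Q.[x] = (1 - dl)^-1 * ((1 - s x ^+ M) ^+ (2 ^ M) + (9^-1 * x ^+ 2) ^+ M).
  rewrite /Q hornerZ hornerD !horner_exp hornerD hornerN hornerZ !horner_exp.
  by rewrite hornerX spE -polyC1 hornerC.
have i0 : 0 < 1 - dl by lra.
have p0 x : 0 <= (1 - s x ^+ M) ^+ (2 ^ M).
  by rewrite /M expnS mulnC exprM; exact: sqr_ge0.
have t0 x : 0 <= (9^-1 * x ^+ 2) ^+ M.
  by rewrite exprn_ge0 // mulr_ge0 ?sqr_ge0 // invr_ge0.
have s01 x : -3 <= x <= 3 -> 0 <= s x <= 1.
  by rewrite /s => /andP[x1 x2]; case: sgE => ->; apply/andP; split; lra.
have sM01 x : -3 <= x <= 3 -> 0 <= s x ^+ M <= 1.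
  by move=> /s01 /andP[a b]; rewrite exprn_ge0 // exprn_ile1.
have p1 x : -3 <= x <= 3 -> (1 - s x ^+ M) ^+ (2 ^ M) <= 1.
  by move=> /sM01 /andP[a b]; rewrite exprn_ile1 // ?subr_ge0 // gerBl.
have t2 x : -2 <= x <= 2 -> (9^-1 * x ^+ 2) ^+ M <= dl.
  move=> /andP[x1 x2]; apply: le_trans (ltW rhoM).
  have q : x ^+ 2 <= 4 by nra.
  have q0 : 0 <= 9^-1 * x ^+ 2 by rewrite mulr_ge0 ?sqr_ge0 // invr_ge0.
  by apply: lerXn2r; rewrite ?nnegrE //; rewrite /rho; lra.
have rho0 : 0 <= rho by rewrite /rho; lra.
exists Q; split => x.
- by rewrite QE; apply: mulr_ge0; [rewrite invr_ge0 ltW|exact: addr_ge0].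
- move=> xe; rewrite QE mulrC ler_pdivlMr // mul1r.
  have [x3|/negP x3] := boolP (-3 <= x <= 3).
    apply: le_trans (_ : (1 - s x ^+ M) ^+ (2 ^ M) <= _); last by rewrite lerDl.
    apply: le_trans (bernoulli_ler _ (sM01 _ x3)).
    rewrite -M2 -exprMn lerD2l lerN2; apply: le_trans (ltW rhoM).
    have /andP[s0 _] := s01 _ x3.
    by apply: lerXn2r; rewrite ?nnegrE ?mulr_ge0 // /s /rho; lra.
  apply: le_trans (_ : (9^-1 * x ^+ 2) ^+ M <= _); last by rewrite lerDr.
  apply: (@le_trans _ _ 1); first by lra.
  apply: exprn_ege1; rewrite mulrC ler_pdivlMr ?mul1r //.
  have [h|h] := leP x 3; last by nra.
  have : x < -3 by rewrite ltNge; apply/negP => h'; apply: x3; apply/andP.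
  nra.
- move=> x2; rewrite QE mulrC ler_pdivrMr //.
  have x3 : -3 <= x <= 3 by move: x2 => /andP[a b]; apply/andP; split; lra.
  have a1 := p1 _ x3; have a2 := t2 _ x2; nra.
- move=> x2 xg; rewrite QE mulrC ler_pdivrMr //.
  have x3 : -3 <= x <= 3 by move: x2 => /andP[a b]; apply/andP; split; lra.
  have a2 := t2 _ x2.
  have := expr_1Bu_le (2 ^ M) (sM01 _ x3); rewrite -M2 -exprMn.
  have a4 : rho ^+ M * (2 * s x) ^+ M >= 1.
    rewrite -exprMn; apply: exprn_ege1; rewrite /rho /s.
    have : sg * (x - g) / 16 <= 0 by rewrite pmulr_lle0 // invr_gt0.
    move: (sg * (x - g) / 16) => v v0; nra.
  have a5 := p0 x.
  move: ((1 - s x ^+ M) ^+ (2 ^ M)) ((2 * s x) ^+ M) a4 a5 => P S a4 a5 a6.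
  have r0 : 0 < rho ^+ M.
    by rewrite exprn_gt0 // /rho; lra.
  have a7 : P <= rho ^+ M.
    apply: (@le_trans _ _ (P * (rho ^+ M * S))); first by rewrite ler_peMr.
    by rewrite mulrCA -[leRHS]mulr1; apply: ler_wpM2l => //; exact: ltW.
  move: (rho ^+ M) rhoM a7 {a4 a6 r0} => r rhoM a7.
  nra.
Qed.

(** The property is proved for all products of [p] with a [scheb 1 i], so that multiplication by
    ['X] can be absorbed by the recursion, which expresses ['X * S_i] as [S_(i+1) + S_(i-1)]. *)
Lemma scheb_span (C : {poly R} -> Prop) : (forall p p', C p -> C p' -> C (p + p')) ->
  (forall (c : R) p, C p -> C (c *: p)) -> (forall r, C (scheb 1 r)) -> forall p, C p.
Proof.
move=> CD CZ CS p; suff : forall i, C (p * scheb 1 i) by move=> /(_ 0%N); rewrite mulr1.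
elim/poly_ind: p => [i|p c IH i].
  by rewrite mul0r -(scale0r (scheb 1 0)); exact: CZ.
rewrite mulrDl mul_polyC; apply: (CD); last exact: CZ.
case: i => [|i]; first by rewrite mulr1 -[X in C (p * X)]/(scheb 1 1); exact: IH.
have -> : p * 'X * scheb 1 i.+1 = p * scheb 1 i.+2 + p * scheb 1 i.
  by rewrite schebSS scale1r; ring.
exact: CD.
Qed.

Lemma count_iota_diam (P : pred nat) n r :
  (forall i j, P i -> P j -> (i <= j + r)%N) -> (count P (iota 0 n) <= r.+1)%N.
Proof.
move=> h; have [/hasP[k kn Pk]|/hasPn no] := boolP (has P (iota 0 n)); last first.
  by rewrite (eq_in_count (a2 := pred0)) ?count_pred0 // => i /no /negbTE.
have ex : exists i, P i by exists k.
case: (ex_minnP ex) => a Pa amin; rewrite -size_filter -(size_iota a r.+1).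
apply: uniq_leq_size; first by rewrite filter_uniq // iota_uniq.
move=> i; rewrite mem_filter mem_iota => /andP[Pi _].
by rewrite mem_iota; have := h _ _ Pi Pa; have := amin _ Pi; lia.
Qed.

End StepPolynomials.

(** * The cost of the monotone transport *)

Section TransportCost.
Variable R : realType.
Implicit Types (s : seq R) (e eta p K : R).
Local Notation F := (@sc_cdf R).

Lemma sc_quantiles n : (0 < n)%N -> exists t : nat -> R,
  [/\ forall i, -2 <= t i <= 2, forall i, (i <= n)%N -> F (t i) = i%:R / n%:R &
      forall i j, (i <= j <= n)%N -> t i <= t j].
Proof.
move=> n0; have n0' : 0 < n%:R :> R by rewrite ltr0n.
have [F2 FN2] := sc_cdf_end R.
(* The minimum keeps the target within the range of [F], so that [t] is defined for every [i]; only
   [i <= n] matters. *)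
have ex (i : nat) : exists y : R, -2 <= y <= 2 /\ F y = Num.min (i%:R / n%:R) 1.
  have cF : {within `[-2, 2], continuous F}.
    by apply: continuous_subspaceT; exact: continuous_sc_cdf.
  have le2 : -2 <= 2 :> R by lra.
  have i0 : 0 <= i%:R / n%:R :> R by rewrite divr_ge0.
  have [|y] := IVT (v := Num.min (i%:R / n%:R) 1) le2 cF.
    rewrite F2 FN2 [Num.min 0 1]min_l // [Num.max 0 1]max_r // le_min i0 ler01 /=.
    by rewrite ge_min lexx orbT.
  by rewrite in_itv /= => y2 Fy; exists y.
have [t tP] := choice ex; exists t.
have Ft i : (i <= n)%N -> F (t i) = i%:R / n%:R.
  move=> ilen; have [_ ->] := tP i; rewrite min_l //.
  by rewrite ler_pdivrMr // mul1r ler_nat.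
split=> // [i|i j /andP[ij jn]]; first by have [] := tP i.
move: ij; rewrite leq_eqVlt => /orP[/eqP -> //|ij].
rewrite leNgt; apply/negP => tji.
have [/andP[j1 _] _] := tP j; have [/andP[_ i2] _] := tP i.
have := sc_cdf_ler j1 (ltW tji) i2.
rewrite !Ft // ?(leq_trans (ltnW ij)) // ler_pM2r ?invr_gt0 // ler_nat leqNgt.
by rewrite ij.
Qed.

Lemma count_ge_sorted s i c : sorted <=%R s -> (i < size s)%N -> c <= nth 0 s i ->
  (size s - i <= count (fun y => (c <= y)%R) s)%N.
Proof.
move=> ss isz ci; rewrite -size_drop -{2}(cat_take_drop i s) count_cat.
apply: leq_trans (leq_addl _ _); rewrite leq_eqVlt; apply/orP; left.
rewrite eq_sym -all_count; apply/(all_nthP 0) => j; rewrite size_drop nth_drop => jlt.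
apply: le_trans ci _; apply: (sorted_leq_nth le_trans le_refl) => //.
- by rewrite inE -ltn_subRL.
- by rewrite leq_addr.
Qed.

Lemma count_le_sorted s i c : sorted <=%R s -> (i < size s)%N -> nth 0 s i <= c ->
  (i.+1 <= count (fun y => (y <= c)%R) s)%N.
Proof.
move=> ss isz ci; rewrite -{1}(cat_take_drop i.+1 s) count_cat.
apply: leq_trans (leq_addr _ _).
have sz : size (take i.+1 s) = i.+1 by rewrite size_takel.
rewrite -[X in (X <= _)%N]sz leq_eqVlt; apply/orP; left.
rewrite eq_sym -all_count; apply/(all_nthP 0) => j; rewrite sz => jlt.
rewrite nth_take //; apply: le_trans ci; apply: (sorted_leq_nth le_trans le_refl) => //.
by rewrite inE; apply: leq_ltn_trans isz; rewrite -ltnS.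
Qed.

Lemma count_has_le (T U : Type) (Q : T -> U -> bool) (l : seq T) (G : seq U) k :
  (forall g, (count (Q^~ g) l <= k)%N) ->
  (count (fun i => has (Q i) G) l <= size G * k)%N.
Proof.
move=> h; elim: G => [|g G IH] /=; first by rewrite (eq_count (a2 := pred0)) // count_pred0.
rewrite mulSn; apply: leq_trans (leq_add (h g) IH).
by rewrite -count_predUI leq_addr.
Qed.

Lemma powR_cost_le p K e x y M : 0 < e -> 2 * e <= 1 -> 1 <= p ->
  p + 1 <= (2 * M)%:R -> 1 <= K -> -2 <= y <= 2 -> forall b : bool,
  (2 * e < `|x - y| -> b) ->
  `|x - y| `^ p <= 2 * e + K `^ p * b%:R +
    2 ^+ (2 * M) / K * (x ^+ (2 * M) + 2 ^+ (2 * M)).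
Proof.
move=> e0 e1 p1 pM K1 y2 b hb.
have p0 : 0 <= p by lra.
have K0 : 0 < K by lra.
have evenX (z : R) : 0 <= z ^+ (2 * M) by rewrite exprM exprn_ge0 // sqr_ge0.
have T0 : 0 <= 2 ^+ (2 * M) / K * (x ^+ (2 * M) + 2 ^+ (2 * M)).
  by rewrite mulr_ge0 ?addr_ge0 // divr_ge0 // ltW.
have Kp0 : 0 <= K `^ p * b%:R by rewrite mulr_ge0 ?powR_ge0.
set u := `|x - y|; have u0 : 0 <= u by exact: normr_ge0.
have [u2|u2] := leP u (2 * e).
  have h1 : u `^ p <= (2 * e) `^ p by apply: ge0_ler_powR; rewrite ?nnegrE //; lra.
  have h2 : (2 * e) `^ p <= 2 * e.
    rewrite -[leRHS]powRr1; last by lra.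
    by apply: ger_powR => //; apply/andP; split; lra.
  by apply: le_trans h1 (le_trans h2 _); rewrite -addrA lerDl addr_ge0.
rewrite (hb u2) mulr1 in Kp0 *.
have [uK|uK] := leP u K.
  have h1 : u `^ p <= K `^ p by apply: ge0_ler_powR; rewrite ?nnegrE //; lra.
  apply: le_trans h1 _; rewrite -addrA addrCA lerDl addr_ge0 //.
  by lra.
have h1 : K * u `^ p <= u ^+ (2 * M).
  apply: (@le_trans _ _ (u `^ 1 * u `^ p)).
    by rewrite powRr1 //; apply: ler_wpM2r; [exact: powR_ge0|exact: ltW].
  rewrite -powRD; last by apply/implyP => _; rewrite gt_eqF //; lra.
  by rewrite -powR_mulrn //; apply: ler_powR; lra.
have h2 : u ^+ (2 * M) <= 2 ^+ (2 * M) * (x ^+ (2 * M) + 2 ^+ (2 * M)).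
  have ux : u <= `|x| + 2.
    apply: le_trans (ler_normB _ _) _; rewrite lerD2l ler_norml.
    by move: y2 => /andP[a1 a2]; apply/andP.
  have xE : `|x| ^+ (2 * M) = x ^+ (2 * M) by rewrite -normrX ger0_norm.
  have [x2|x2] := leP `|x| 2.
    apply: (@le_trans _ _ ((2 * 2) ^+ (2 * M))).
      by apply: lerXn2r; rewrite ?nnegrE //; lra.
    by rewrite exprMn; apply: ler_wpM2l; rewrite ?evenX // lerDr.
  apply: (@le_trans _ _ ((2 * `|x|) ^+ (2 * M))).
    by apply: lerXn2r; rewrite ?nnegrE //; lra.
  by rewrite exprMn xE; apply: ler_wpM2l; rewrite ?evenX // lerDl.
have h3 : u `^ p <= 2 ^+ (2 * M) / K * (x ^+ (2 * M) + 2 ^+ (2 * M)).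
  by rewrite mulrAC ler_pdivlMr // mulrC; exact: le_trans h1 h2.
apply: le_trans h3 _; rewrite lerDr addr_ge0 //; lra.
Qed.

Definition seq_mean s (Q : {poly R}) : R := (\sum_(y <- s) Q.[y]) / (size s)%:R.

(** The [i]-th smallest atom receives the [i]-th quantile cell of the semicircle law. A displacement
    above [2 * e] leaves a grid point [g] between the two positions, at distance at least [e] from
    the atom; the counting hypotheses then force [i] to be close to [n * F g], which happens for few
    [i]. *)
Lemma inf_coupling_le s (G : seq R) e eta p K M : (0 < size s)%N -> sorted <=%R s ->
  0 < e -> 2 * e <= 1 -> 0 <= eta -> 1 <= p -> p + 1 <= (2 * M)%:R -> 1 <= K ->
  {in G, forall g, -2 <= g <= 2} ->
  (forall y, -2 <= y <= 2 -> (exists2 g, g \in G & y <= g <= y + e) /\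
     (exists2 g, g \in G & y - e <= g <= y)) ->
  {in G, forall g, (count (fun y => (g + e <= y)%R) s)%:R <= (size s)%:R * (1 - F g + eta)} ->
  {in G, forall g, (count (fun y => (y <= g - e)%R) s)%:R <= (size s)%:R * (F g + eta)} ->
  (ereal_inf [set (\int[g]_(z in setT) ((`|z.1 - z.2| `^ p)%:E))%E
     | g in [set g : probability (R * R)%type R | coupling (empirical s) (@semicircle R) g]]
   <= (2 * e + K `^ p * ((size G)%:R * (2 * eta + 3 / (size s)%:R)) +
       2 ^+ (2 * M) / K * (seq_mean s 'X^(2 * M) + 2 ^+ (2 * M)))%:E)%E.
Proof.
move=> n0 ss e0 e1 eta0 p1 pM K1 G2 grid ha hb.
set n := size s in n0 ha hb *; have n0' : 0 < n%:R :> R by rewrite ltr0n.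
(* The cells below are half-open to be disjoint, and empty from index [n] on because disjointness is
   required over all indices. *)
have [t [t2 Ft tle]] := sc_quantiles n0.
pose cell i : set R := if (i < n)%N then `[t i, t i.+1[%classic else set0.
have cellP i y : cell i y -> (i < n)%N /\ (t i <= y < t i.+1).
  by rewrite /cell; case: ifPn => // ilt; rewrite /= in_itv.
have cell_meas i : measurable (cell i).
  by rewrite /cell; case: ifPn => _; [exact: measurable_itv|exact: measurable0].
have cell_triv : trivIset setT cell.
  have lt i j y : (i < j)%N -> cell i y -> cell j y -> False.
    move=> ij /cellP[_ /andP[_ yi]] /cellP[jn /andP[yj _]].
    have tij : t i.+1 <= t j by apply: tle; rewrite ij ltnW.
    by have := lt_le_trans yi (le_trans tij yj); rewrite ltxx.
  move=> i j _ _ [y [ci cj]]; case: (ltngtP i j) => // ij.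
    by case: (lt _ _ _ ij ci cj).
  by case: (lt _ _ _ ij cj ci).
have cell_mass i : (i < n)%N -> @semicircle R (cell i) = (n%:R^-1)%:E.
  move=> ilt; rewrite /cell ilt.
  have /andP[a1 _] := t2 i; have /andP[_ a2] := t2 i.+1.
  rewrite semicircle_itv // ?tle ?leqnSn // !Ft ?(ltnW ilt) //.
  by congr (_%:E); rewrite -mulrBl -natr1 addrAC subrr add0r mul1r.
pose x i := nth 0 s i.
pose near_ (i : nat) g := `|i%:R - n%:R * F g| <= n%:R * eta + 1.
pose bad i := has (near_ i) G.
have hbad i y : cell i y -> 2 * e < `|x i - y| -> bad i.
  move=> /cellP[ilt /andP[ty yt]]; have /andP[ti2 _] := t2 i; have /andP[_ ti3] := t2 i.+1.
  have y2 : -2 <= y <= 2 by apply/andP; split; lra.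
  have [[g gG /andP[g1 g2]] [g' gG' /andP[g1' g2']]] := grid _ y2.
  rewrite lter_normr => /orP[far|far].
    (* The [n - i] largest atoms exceed [g + e], so [i >= n * (F g - eta)], while [t i <= g] gives
       [i <= n * F g]. In the symmetric case below [i.+1] replaces [i], whence the [+ 1] in
       [near_]. *)
    apply/hasP; exists g => //; rewrite /near_.
    have c1 : g + e <= x i by lra.
    have := count_ge_sorted ss ilt c1; rewrite -(ler_nat R) natrB ?(ltnW ilt) // => c2.
    have c3 := le_trans c2 (ha g gG).
    have /andP[_ gg2] := G2 _ gG.
    have c4 : F (t i) <= F g by apply: sc_cdf_ler => //; exact: le_trans g1.
    rewrite Ft ?(ltnW ilt) // ler_pdivrMr // mulrC in c4.
    by rewrite ler_norml; apply/andP; split; lra.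
  apply/hasP; exists g' => //; rewrite /near_.
  have c1 : x i <= g' - e by lra.
  have := count_le_sorted ss ilt c1; rewrite -(ler_nat R) => c2.
  have c3 := le_trans c2 (hb g' gG').
  have /andP[gg2 _] := G2 _ gG'.
  have c4 : F g' <= F (t i.+1) by apply: sc_cdf_ler => //; lra.
  rewrite Ft // ler_pdivlMr // mulrC -natr1 in c4; rewrite -natr1 in c3.
  by rewrite ler_norml; apply/andP; split; lra.
(* For each grid point the indices lie in an interval of length [2 * (n * eta + 1)], which contains
   at most that many integers plus one. *)
have cbad : (count bad (iota 0 n))%:R <= (size G)%:R * (2 * (n%:R * eta) + 3).
  pose r := Num.truncn (2 * (n%:R * eta + 1)).
  have rho0 : 0 <= 2 * (n%:R * eta + 1) by rewrite mulr_ge0 // addr_ge0 // mulr_ge0.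
  have /andP[r1 r2] := truncn_itv rho0.
  have := @count_has_le _ _ near_ (iota 0 n) G r.+1 _.
  move=> /(_ _)/wrap[]; last first.
    rewrite -(ler_nat R) natrM => h; apply: le_trans h _; apply: ler_wpM2l => //.
    by rewrite -natr1; move: r1; rewrite -/r; lra.
  move=> g; apply: count_iota_diam => i j; rewrite /near_ !ler_norml => /andP[i1 i2] /andP[j1 j2].
  rewrite leqNgt; apply/negP => ij.
  have : (j + r).+1%:R <= i%:R :> R by rewrite ler_nat.
  rewrite -natr1 natrD; move: r2; rewrite -/r -natr1; lra.
pose h i := 2 * e + K `^ p * (bad i)%:R +
    2 ^+ (2 * M) / K * (x i ^+ (2 * M) + 2 ^+ (2 * M)).
have evenX (z : R) : 0 <= z ^+ (2 * M) by rewrite exprM exprn_ge0 // sqr_ge0.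
have h0 i : 0 <= h i.
  rewrite /h !addr_ge0 // ?mulr_ge0 ?powR_ge0 ?addr_ge0 ?evenX ?invr_ge0 //; lra.
have hx i y : (i < n)%N -> cell i y -> `|x i - y| `^ p <= h i.
  move=> ilt cy; apply: powR_cost_le => //; last exact: hbad.
  have [_ /andP[y1 y2]] := cellP _ _ cy; have /andP[a1 _] := t2 i; have /andP[_ a2] := t2 i.+1.
  by apply/andP; split; lra.
have sE : [seq x i | i <- iota 0 n] = s by rewrite -[RHS](mkseq_nth 0).
have cpl := @transport_plan_coupling R (@semicircle R) n cell x n0 cell_meas cell_triv cell_mass.
rewrite sE in cpl.
have cost := @transport_plan_cost R (@semicircle R) n cell x n0 cell_meas cell_triv cell_mass p h h0 hx.
apply: (@le_trans _ _ ((\sum_(i <- iota 0 n) h i) / n%:R)%:E).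
  by apply: le_trans cost; apply: ereal_inf_lbound; eexists; [exact: cpl|].
rewrite lee_fin ler_pdivrMr // /h !big_split /= -!mulr_sumr !big_split /=.
have cst (c : R) : \sum_(i <- iota 0 n) c = n%:R * c.
  by rewrite big_const_seq count_predT size_iota iter_addr_0 mulr_natl.
rewrite !cst.
have -> : \sum_(i <- iota 0 n) (bad i)%:R = (count bad (iota 0 n))%:R :> R.
  rewrite -sum1_count natr_sum [RHS]big_mkcond; apply: eq_bigr => i _.
  by case: (bad i).
have -> : \sum_(i <- iota 0 n) x i ^+ (2 * M) = n%:R * seq_mean s 'X^(2 * M).
  rewrite /seq_mean mulrC divfK ?gt_eqF // -[in RHS]sE big_map.
  by apply: eq_bigr => i _; rewrite hornerXn.
have hK : K `^ p * (count bad (iota 0 n))%:R <=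
    K `^ p * ((size G)%:R * (2 * eta + 3 / n%:R)) * n%:R.
  rewrite -mulrA; apply: ler_wpM2l; first exact: powR_ge0.
  apply: le_trans cbad _; rewrite -mulrA; apply: ler_wpM2l => //.
  rewrite le_eqVlt; apply/orP; left; apply/eqP; field; lra.
rewrite [leRHS]mulrDl [X in _ <= X + _]mulrDl; apply: lerD.
  by apply: lerD => //; rewrite le_eqVlt; apply/orP; left; apply/eqP; ring.
by rewrite -mulrDr mulrCA [leRHS]mulrC.
Qed.

End TransportCost.

(** * From moments to the Wasserstein distance *)

Section AtomsOfGraph.
Variable R : realType.
Implicit Types (s : seq R) (Q : {poly R}).

(* s lists the normalized eigenvalues of g. *)
Record graph_atoms (q n : nat) (g : graph n) s : Prop := GraphAtoms {
  atoms_sorted : sorted <=%R s;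
  atoms_size : size s = n;
  atoms_law : @spectral_measure R q n g = empirical s;
  atoms_scheb : forall L r, few_cycles g q.+1 L -> (r <= L)%N ->
    0 <= seq_mean s (scheb 1 r) <= (r.+1 ^ 2)%:R / Num.sqrt q%:R ^+ r }.

Lemma graph_atoms_ex q n (g : graph n) : (0 < q)%N -> (0 < n)%N ->
  regular_graph q.+1 g -> exists s, graph_atoms q g s.
Proof.
case: n g => // n g q0 _ rg.
have symA : (adjmx R g)^T = adjmx R g.
  by apply/matrixP => i j; rewrite mxE (adjmx_sym R rg).
have [l [sl chE trE]] := real_symmetric_spectrum symA.
pose sq := Num.sqrt q%:R : R.
have sq0 : 0 < sq by rewrite sqrtr_gt0 ltr0n.
pose l' := [seq x / sq | x <- l]; pose s := sort <=%R l'.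
have ps : perm_eq s l' by rewrite perm_sort.
have sz : size s = n.+1 by rewrite (perm_size ps) size_map.
exists s; split=> //.
- exact: (sort_sorted le_total).
- rewrite (spectral_measureE q sl chE); apply/funext => B.
  by rewrite /empirical (perm_size ps) -/sq -/l' (seq.permP ps).
move=> L r few rL; have := trace_scheb_bounds R rg few rL.
have -> : \tr (horner_mx (adjmx R g) (scheb q%:R r)) =
    sq ^+ r * (n.+1%:R * seq_mean s (scheb 1 r)).
  rewrite trE /seq_mean sz [n.+1%:R * _]mulrC divfK ?pnatr_eq0 //.
  rewrite (perm_big _ ps) big_map mulr_sumr; apply: eq_bigr => x _.
  rewrite -scheb_scale mulrC divfK ?gt_eqF //.
  by rewrite sqr_sqrtr // ler0n.
have sr0 : 0 < sq ^+ r by rewrite exprn_gt0.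
have n0 : 0 < n.+1%:R :> R by rewrite ltr0n.
rewrite pmulr_rge0 // pmulr_rge0 // => /andP[-> h] /=.
rewrite ler_pdivlMr // -(ler_pM2l n0) [leRHS]mulrC -natrM.
by rewrite mulrA [_ * sq ^+ r]mulrC.
Qed.

(** Markov's inequality, with [Q] dominating the indicator of [P]. *)
Lemma count_le_seq_mean s Q (P : pred R) : (0 < size s)%N -> (forall x, 0 <= Q.[x]) ->
  (forall x, P x -> 1 <= Q.[x]) -> (count P s)%:R <= (size s)%:R * seq_mean s Q.
Proof.
move=> s0 Q0 Q1; rewrite /seq_mean mulrC divfK ?pnatr_eq0 -?lt0n //.
rewrite -sum1_count natr_sum big_mkcond; apply: ler_sum => x _.
by case: ifPn => [/Q1|].
Qed.

End AtomsOfGraph.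

(** * Deterministic convergence for graphs with few short cycles *)

Section Convergence.
Variables (R : realType) (q : nat -> nat) (G : forall n, graph n).
Hypothesis q_gt0 : forall n, (0 < q n)%N.
Hypothesis q_inf : forall M : nat, exists N : nat, forall n, (N <= n)%N -> (M <= q n)%N.
Hypothesis G_regular : forall n, good q n -> regular_graph (q n).+1 (G n).
Hypothesis G_few_cycles : forall L, exists N, forall n, (N <= n)%N -> good q n ->
  few_cycles (G n) (q n).+1 L.

(** The threshold is uniform over all lists [s] of atoms, so such properties can be intersected
    before a list is chosen. *)
Definition eventually_good (P : nat -> seq R -> Prop) := exists N, forall n, (N <= n)%N ->
  good q n -> forall s, graph_atoms (q n) (G n) s -> P n s.

Lemma eventually_goodI P P' : eventually_good P -> eventually_good P' ->
  eventually_good (fun n s => P n s /\ P' n s).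
Proof.
move=> [N h] [N' h']; exists (maxn N N') => n; rewrite geq_max => /andP[n1 n2] gn s As.
by split; [exact: h|exact: h'].
Qed.

Lemma eventually_goodS (P P' : nat -> seq R -> Prop) :
  (forall n s, good q n -> graph_atoms (q n) (G n) s -> P n s -> P' n s) ->
  eventually_good P -> eventually_good P'.
Proof.
by move=> PP' [N h]; exists N => n Nn gn s As; apply: PP' => //; exact: h.
Qed.

Lemma eventually_good_in (T : eqType) (l : seq T) (P : T -> nat -> seq R -> Prop) :
  (forall x, x \in l -> eventually_good (P x)) ->
  eventually_good (fun n s => forall x, x \in l -> P x n s).
Proof.
elim: l => [|y l IH] h; first by exists 0%N.
have h1 : eventually_good (P y) by apply: h; rewrite inE eqxx.
have h2 : eventually_good (fun n s => forall x, x \in l -> P x n s).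
  by apply: IH => x xl; apply: h; rewrite inE xl orbT.
apply: eventually_goodS (eventually_goodI h1 h2) => n s _ _ [py pl] x.
by rewrite inE => /orP[/eqP ->|/pl].
Qed.

Lemma eventually_large (c : R) : eventually_good (fun n s => c <= n%:R).
Proof.
exists (Num.truncn c).+1 => n Nn _ s _; apply: ltW; apply: lt_le_trans (truncnS_gt c) _.
by rewrite ler_nat.
Qed.

(** Both means are linear in [Q], so [scheb_span] reduces the claim to [scheb 1 r]. For [r = 0] both
    equal 1; for [r > 0] the semicircle mean is 0 and the empirical one is bounded by
    [atoms_scheb]. *)
Lemma seq_mean_cvg Q : forall eta, 0 < eta ->
  eventually_good (fun n s => `|seq_mean s Q - sc_mean Q| < eta).
Proof.
elim/scheb_span: Q => [Q Q' h h' eta eta0|c Q h eta eta0|r eta eta0].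
- have e2 : 0 < eta / 2 by rewrite divr_gt0.
  apply: eventually_goodS (eventually_goodI (h _ e2) (h' _ e2)) => n s _ _ [h1 h2].
  have -> : seq_mean s (Q + Q') = seq_mean s Q + seq_mean s Q'.
    by rewrite /seq_mean -mulrDl -big_split /=; congr (_ / _); apply: eq_bigr => x _; rewrite hornerD.
  rewrite sc_meanD opprD addrACA [eta]splitr.
  by apply: le_lt_trans (ler_normD _ _) _; exact: ltrD.
- have e2 : 0 < eta / (`|c| + 1) by rewrite divr_gt0 // ltr_pwDr.
  apply: eventually_goodS (h _ e2) => n s _ _ h1.
  have -> : seq_mean s (c *: Q) = c * seq_mean s Q.
    rewrite /seq_mean mulrA mulr_sumr; congr (_ / _).
    by apply: eq_bigr => x _; rewrite hornerZ.
  rewrite sc_meanZ -mulrBr normrM.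
  apply: (@le_lt_trans _ _ ((`|c| + 1) * `|seq_mean s Q - sc_mean Q|)).
    by apply: ler_wpM2r => //; rewrite lerDl.
  by rewrite mulrC -ltr_pdivlMr // ltr_pwDr.
case: r => [|r].
  exists 0%N => n _ gn s [_ sz _ _]; rewrite sc_mean1 /seq_mean sz.
  under eq_bigr do rewrite hornerE.
  rewrite big_const_seq count_predT sz iter_addr_0 divff ?subrr ?normr0 //.
  by rewrite pnatr_eq0 -lt0n; case/andP: gn.
have [N1 h1] := G_few_cycles r.+1.
(* It suffices that the square root of [q n] exceeds [c] and 1, its power [r.+1] being then at least
   itself. *)
pose c : R := (r.+2 ^ 2)%:R / eta.
have c0 : 0 < c by rewrite divr_gt0 // ltr0n expn_gt0.
have [N2 h2] := q_inf (Num.truncn (c ^+ 2)).+1.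
exists (maxn N1 N2) => n; rewrite geq_max => /andP[n1 n2] gn s As.
rewrite sc_mean_scheb subr0.
have /andP[m0 m1] := atoms_scheb As (h1 n n1 gn) (leqnn _).
rewrite ger0_norm //; apply: le_lt_trans m1 _.
have qc : c < Num.sqrt (q n)%:R.
  rewrite -[X in X < _]ger0_norm ?(ltW c0) // -sqrtr_sqr ltr_sqrt ?ltr0n //.
  by apply: lt_le_trans (truncnS_gt _) _; rewrite ler_nat h2.
have q1 : 1 <= Num.sqrt (q n)%:R :> R.
  by rewrite -[leLHS]sqrtr1; apply: ler_wsqrtr; rewrite ler1n.
rewrite ltr_pdivrMr; last by rewrite exprn_gt0 // (lt_trans c0).
rewrite mulrC -ltr_pdivrMr //; apply: lt_le_trans qc _.
by rewrite exprS ler_peMr ?exprn_ege1 // (le_trans _ q1).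
Qed.

(** The sign treats both tails at once: [sg = 1] counts atoms above [g + e], [sg = -1] those below
    [g - e]. The step polynomial dominates the indicator, and each of the two errors, in its
    semicircle mean and in the convergence of means, takes half of [eta]. *)
Lemma eventually_count (sg g e eta : R) : sg = 1 \/ sg = -1 -> -2 <= g <= 2 ->
  0 < e <= 1 -> 0 < eta ->
  eventually_good (fun n s => (count (fun y => e <= sg * (y - g)) s)%:R <=
    n%:R * ((if sg == 1 then 1 - sc_cdf g else sc_cdf g) + eta)).
Proof.
move=> sgE g2 e01 eta0; have e2 : 0 < eta / 2 by rewrite divr_gt0.
have [Q [Q0 Q1 Q2 Q3]] := step_polynomial sgE g2 e01 e2.
have [g1' g2'] := andP g2.
have mean : sc_mean Q <= (if sg == 1 then 1 - sc_cdf g else sc_cdf g) + eta / 2.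
  have [F2 FN2] := sc_cdf_end R.
  case: sgE Q1 Q3 => -> Q1 Q3; rewrite ?eqxx.
    apply: le_trans (@sc_mean_le R Q (eta / 2) (1 + eta / 2) g g2 _ _) _.
    - move=> x /andP[x1 x2]; apply: Q3; [apply/andP; split; lra|lra].
    - move=> x /andP[x1 x2]; apply: Q2; apply/andP; split; lra.
    - by move: (sc_cdf g) => F; lra.
  have -> : (-1 == 1 :> R) = false by apply/eqP; lra.
  apply: le_trans (@sc_mean_le R Q (1 + eta / 2) (eta / 2) g g2 _ _) _.
  - move=> x /andP[x1 x2]; apply: Q2; apply/andP; split; lra.
  - move=> x /andP[x1 x2]; apply: Q3; [apply/andP; split; lra|lra].
  - by move: (sc_cdf g) => F; lra.
apply: eventually_goodS (seq_mean_cvg Q e2) => n s gn [_ sz _ _] h.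
have n0 : (0 < size s)%N by rewrite sz; case/andP: gn.
apply: le_trans (count_le_seq_mean n0 Q0 Q1) _; rewrite sz ler_wpM2l //.
move: h; rewrite ltr_norml => /andP[_ h].
by lra.
Qed.

Lemma grid_ex (e : R) : 0 < e -> exists L : seq R, [/\ (0 < size L)%N,
  {in L, forall g, -2 <= g <= 2} &
  forall y, -2 <= y <= 2 -> (exists2 g, g \in L & y <= g <= y + e) /\
     (exists2 g, g \in L & y - e <= g <= y)].
Proof.
move=> e0; pose k := (Num.truncn (4 / e)).+1.
have k0 : 0 < k%:R :> R by rewrite ltr0n.
have ke : 4 <= e * k%:R.
  by rewrite mulrC -ler_pdivrMr // ltW // truncnS_gt.
pose gr (j : nat) : R := -2 + 4 * (j%:R / k%:R).
have inL j : (j <= k)%N -> gr j \in [seq gr j | j <- iota 0 k.+1].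
  by move=> jk; apply/mapP; exists j; rewrite // mem_iota.
have grS j : gr j.+1 <= gr j + e.
  have h : 4 / k%:R <= e by rewrite ler_pdivrMr.
  by rewrite /gr -natr1 mulrDl mul1r; lra.
have gr_le j : (j <= k)%N -> -2 <= gr j <= 2.
  move=> jk; have h0 : 0 <= j%:R / k%:R :> R by rewrite divr_ge0.
  have h1 : j%:R / k%:R <= 1 :> R by rewrite ler_pdivrMr // mul1r ler_nat.
  by apply/andP; split; rewrite /gr; lra.
exists [seq gr j | j <- iota 0 k.+1]; split => //.
  by move=> g /mapP[j]; rewrite mem_iota => /andP[_ jk] ->; exact: gr_le.
move=> y /andP[y1 y2]; pose z := (y + 2) / 4 * k%:R.
have z0 : 0 <= z by rewrite mulr_ge0 // divr_ge0 //; lra.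
pose j := Num.truncn z; have /andP[j1 j2] := truncn_itv z0.
have zk : z <= k%:R by rewrite /z ler_piMl //; lra.
have jk : (j <= k)%N by rewrite -(ler_nat R); exact: le_trans zk.
have yE : y = -2 + 4 * (z / k%:R) by rewrite /z mulfK ?gt_eqF //; lra.
have lo : gr j <= y.
  by rewrite yE /gr lerD2l ler_pM2l // ler_pM2r ?invr_gt0.
have hi : y < gr j.+1.
  by rewrite yE /gr ltrD2l ltr_pM2l // ltr_pM2r ?invr_gt0.
have step := grS j.
split; last by exists (gr j); [exact: inL|apply/andP; split; lra].
move: jk; rewrite leq_eqVlt => /orP[/eqP jk|jk].
  exists (gr k); first exact: inL.
  have -> : gr k = 2 by rewrite /gr divff ?gt_eqF //; lra.
  have : gr j = 2 by rewrite jk /gr divff ?gt_eqF //; lra.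
  by move=> h; apply/andP; split; lra.
by exists (gr j.+1); [exact: inL|apply/andP; split; lra].
Qed.

Lemma Wasserstein_cvg p e : 1 <= p -> 0 < e -> exists N : nat, forall n, (N <= n)%N -> good q n ->
  (Wasserstein p (@spectral_measure R (q n) n (G n)) (@semicircle R) < e%:E)%E.
Proof.
move=> p1 e0; have p0 : 0 < p by lra.
(* The infimum will be at most [E], and the factor 1/2 makes the final inequality strict. Each of
   the three error terms gets [E / 4]: [K] is chosen for the tail, [d] for small displacements, then
   [eta] and [n] for the bad cells. *)
pose E := e `^ p / 2.
have E0 : 0 < E by rewrite divr_gt0 // powR_gt0.
pose M := (Num.truncn (p + 1)).+1.
have pM : p + 1 <= (2 * M)%:R.
  apply: ltW; apply: lt_le_trans (truncnS_gt (p + 1)) _.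
  by rewrite ler_nat mul2n -addnn leq_addr.
(* Convergence of means with tolerance 1 makes [m0] an eventual bound for the empirical moment of
   order [2 * M]. *)
pose m0 := `|@sc_mean R 'X^(2 * M)| + 1.
have evenX (z : R) : 0 <= z ^+ (2 * M) by rewrite exprM exprn_ge0 // sqr_ge0.
pose C : R := 2 ^+ (2 * M) * (m0 + 2 ^+ (2 * M)).
have C0 : 0 <= C by rewrite mulr_ge0 // addr_ge0 // addr_ge0.
pose K := 1 + 4 * C / E.
have CE : 0 <= 4 * C / E by apply: divr_ge0; [exact: mulr_ge0|exact: ltW].
have K1 : 1 <= K by rewrite lerDl.
have CK : C / K <= E / 4.
  rewrite ler_pdivrMr ?(lt_le_trans _ K1) // /K mulrDr mulr1.
  have -> : E / 4 * (4 * C / E) = C by field; rewrite gt_eqF.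
  by rewrite lerDr; apply: divr_ge0 => //; exact: ltW.
pose d := E / (8 + 2 * E).
have d8 : 0 < 8 + 2 * E by lra.
have d0 : 0 < d by rewrite divr_gt0.
have d1 : 2 * d <= 1 by rewrite mulrA ler_pdivrMr //; lra.
have dE : 2 * d <= E / 4 by rewrite mulrA ler_pdivrMr //; nra.
have [L [L0 L2 grid]] := grid_ex d0.
pose B := K `^ p * (size L)%:R.
have B0 : 0 < B by rewrite mulr_gt0 ?ltr0n // powR_gt0 // (lt_le_trans _ K1).
pose eta := E / (16 * B).
have eta0 : 0 < eta by rewrite divr_gt0 // mulr_gt0.
have d01 : 0 < d <= 1 by apply/andP; split; lra.
have ha := eventually_good_in (fun g gL => eventually_count (or_introl (erefl 1)) (L2 g gL) d01 eta0).
have hb := eventually_good_in (fun g gL => eventually_count (or_intror (erefl (-1))) (L2 g gL) d01 eta0).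
have hm := seq_mean_cvg 'X^(2 * M) ltr01.
have hn := eventually_large (24 * B / E).
have [N hN] := eventually_goodI (eventually_goodI ha hb) (eventually_goodI hm hn).
exists N => n Nn gn; have n0 : (0 < n)%N by case/andP: gn.
have [s As] := graph_atoms_ex R (q_gt0 n) n0 (G_regular gn).
have [[{}ha {}hb] [{}hm {}hn]] := hN n Nn gn s As.
case: As => ss sz -> _.
have s0 : (0 < size s)%N by rewrite sz.
have n0' : 0 < n%:R :> R by rewrite ltr0n.
have ha' : {in L, forall g, (count (fun y => (g + d <= y)%R) s)%:R <=
    (size s)%:R * (1 - sc_cdf g + eta)}.
  move=> g gL; have := ha g gL; rewrite eqxx sz; apply: le_trans.
  by rewrite ler_nat; apply: sub_count => y /= h; rewrite mul1r; lra.
have hb' : {in L, forall g, (count (fun y => (y <= g - d)%R) s)%:R <=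
    (size s)%:R * (sc_cdf g + eta)}.
  move=> g gL; have := hb g gL; rewrite (_ : (-1 == 1 :> R) = false) ?sz; last by apply/eqP; lra.
  apply: le_trans; rewrite ler_nat; apply: sub_count => y /= h; lra.
have bound := inf_coupling_le s0 ss d0 d1 (ltW eta0) p1 pM K1 L2 grid ha' hb'.
set I := ereal_inf _ in bound; rewrite /Wasserstein -/I.
have IE : (I <= E%:E)%E.
  apply: le_trans bound _; rewrite lee_fin sz.
  have t2 : K `^ p * ((size L)%:R * (2 * eta + 3 / n%:R)) <= E / 4.
    rewrite mulrA -/B mulrDr.
    have -> : B * (2 * eta) = E / 8 by rewrite /eta; field; rewrite gt_eqF.
    have : B * (3 / n%:R) <= E / 8.
      rewrite mulrA ler_pdivrMr //; move: hn; rewrite ler_pdivrMr // => hn.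
      by lra.
    by lra.
  have t3 : 2 ^+ (2 * M) / K * (seq_mean s 'X^(2 * M) + 2 ^+ (2 * M)) <= E / 4.
    apply: le_trans CK; rewrite /C mulrAC; apply: ler_wpM2r.
      by rewrite invr_ge0 (le_trans _ K1).
    apply: ler_wpM2l => //; rewrite lerD2r /m0.
    move: hm; rewrite ltr_norml => /andP[_ hm].
    by have := ler_norm (@sc_mean R 'X^(2 * M)); lra.
  by lra.
have I0 : (0 <= I)%E.
  apply: le_ereal_inf_tmp => _ [g _ <-]; apply: integral_ge0 => z _.
  by rewrite lee_fin powR_ge0.
apply: (@le_lt_trans _ _ (poweR E%:E p^-1)).
  apply: gt0_ler_poweR => //; first by rewrite invr_ge0 ltW.
  - by rewrite in_itv /= I0 leey.
  - by rewrite in_itv /= lee_fin (ltW E0) leey.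
rewrite poweR_EFin lte_fin.
have -> : e = (e `^ p) `^ p^-1.
  by rewrite -powRrM mulfV ?gt_eqF // powRr1 // ltW.
apply: gt0_ltr_powR; rewrite ?invr_gt0 ?nnegrE ?powR_ge0 //; first by rewrite ltW.
by rewrite /E; have := powR_gt0 p e0; lra.
Qed.

End Convergence.

(** * Random regular graphs *)

Lemma set_seq_cons (T : eqType) (x : T) (l : seq T) :
  [set` x :: l] = [set x] `|` [set` l].
Proof.
apply/seteqP; split => y /=; rewrite inE.
  by move=> /orP[/eqP ->|h]; [left|right].
by move=> [->|h]; rewrite ?eqxx // h orbT.
Qed.

(** * A Borel-Cantelli lemma with telescoping bounds *)

Section BorelCantelli.
Variables (R : realType) (d : measure_display) (Omega : measurableType d).
Variable P : probability Omega R.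

(** The telescoping bound keeps every partial sum of probabilities below [v N], so the series
    converges and the limsup of the events is null. *)
Lemma ae_eventually_not (F : nat -> set Omega) (v : nat -> R) N :
  (forall n, measurable (F n)) -> (forall n, 0 <= v n) ->
  (forall n, (N <= n)%N -> (P (F n) <= (v n - v n.+1)%:E)%E) ->
  {ae P, forall w, exists M, forall n, (M <= n)%N -> ~ F n w}.
Proof.
move=> mF v0 hF; pose F' n := F (n + N)%N.
exists (lim_sup_set F'); split.
- by apply: bigcap_measurable => // n _; apply: bigcup_measurable => j _; exact: mF.
- apply: lim_sup_set_cvg0; first by move=> n; exact: mF.
  apply: (@le_lt_trans _ _ (v N)%:E); last exact: ltry.
  apply: lime_le; first by apply: is_cvg_nneseries => n _ _; exact: measure_ge0.
  apply: nearW => n; apply: (@le_trans _ _ (v N - v (n + N)%N)%:E).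
    elim: n => [|n IH]; first by rewrite big_geq // subrr.
    rewrite big_nat_recr //=; apply: le_trans (leeD IH (hF _ _)) _; first by rewrite leq_addl.
    by rewrite -EFinD lee_fin addSn; lra.
  by rewrite lee_fin gerBl.
- move=> w /= h n _; apply: contrapT => hn; apply: h.
  exists (n + N)%N => k nk Fk; apply: hn; exists (k - N)%N => /=.
    by rewrite leq_subRL ?(leq_trans _ nk) ?leq_addl // addnC.
  by rewrite /F' subnK // (leq_trans _ nk) // leq_addl.
Qed.

(** The integral comparison for the sum of [n^(-3/2)] in discrete form: [b - a = 1 / (a + b)], and
    [a + b <= 2 * b]. *)
Lemma inv_n32_telescope m : (0 < m)%N ->
  (m.+1%:R * Num.sqrt m.+1%:R)^-1 <= 2 / Num.sqrt m%:R - 2 / Num.sqrt m.+1%:R :> R.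
Proof.
move=> m0; set a := Num.sqrt m%:R; set b := Num.sqrt m.+1%:R.
have a0 : 0 < a by rewrite sqrtr_gt0 ltr0n.
have b0 : 0 < b by rewrite sqrtr_gt0 ltr0n.
have aE : a ^+ 2 = m%:R by rewrite sqr_sqrtr.
have bE : b ^+ 2 = m.+1%:R by rewrite sqr_sqrtr.
have ab : b ^+ 2 = a ^+ 2 + 1 by rewrite aE bE natr1.
have lab : a <= b by rewrite ler_sqrt ?ler_nat // ltr0n.
rewrite -bE -exprSr.
have -> : 2 / a - 2 / b = 2 * (b - a) / (a * b) by field; lra.
rewrite ler_pdivlMr ?mulr_gt0 // mulrC ler_pdivrMr ?exprn_gt0 //.
have h1 : (b - a) * (a + b) = 1.
  have -> : (b - a) * (a + b) = b ^+ 2 - a ^+ 2 by ring.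
  by rewrite ab addrAC subrr add0r.
have h2 : 1 <= 2 * (b - a) * b by nra.
apply: (@le_trans _ _ (b ^+ 2)).
  by rewrite expr2; apply: ler_wpM2r => //; exact: ltW.
have := ler_wpM2r (sqr_ge0 b) h2; rewrite mul1r.
by have -> : 2 * (b - a) * b * b ^+ 2 = 2 * (b - a) * b ^+ 3 by ring.
Qed.

End BorelCantelli.

(** * Almost sure scarcity of short cycles *)

Section RandomGraphs.
Variables (R : realType) (q : nat -> nat).
Hypothesis q_gt0 : forall n, (0 < q n)%N.
Hypothesis q_inf : forall M : nat, exists N : nat, forall n, (N <= n)%N -> (M <= q n)%N.
Hypothesis q_log : (fun n : nat => ln ((q n)%:R : R) / ln (n%:R : R)) @ \oo --> (0 : R).

(** The logarithmic hypothesis gives [q ^ (2 * a) <= n]; doubling the exponent leaves room to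
    replace [q] by [q + 2], which is at most [q ^ 2] once [q >= 2]. *)
Lemma q_small_power a : exists N, forall n, (N <= n)%N -> ((q n).+2 ^ a <= n)%N.
Proof.
have e0 : 0 < (2 * a).+1%:R^-1 :> R by rewrite invr_gt0 ltr0n.
have /cvgrPdist_lt/(_ _ e0)[N1 _ h1] := q_log.
have [N2 h2] := q_inf 2.
exists (maxn 2 (maxn N1 N2)) => n; rewrite !geq_max => /and3P[n2 n1 nN2].
have q2 := h2 n nN2.
have lnn : 0 < ln (n%:R : R) by rewrite ln_gt0 // ltr1n.
have lnq : 0 <= ln ((q n)%:R : R) by rewrite ln_ge0 // ler1n.
have := h1 n n1; rewrite /= sub0r normrN ger0_norm ?divr_ge0 ?(ltW lnn) //.
rewrite ltr_pdivrMr // mulrC ltr_pdivlMr ?ltr0n // => h.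
have h' : ln (((q n)%:R : R) ^+ (2 * a)) <= ln (n%:R : R).
  rewrite lnXn ?ltr0n //; apply: le_trans (ltW h).
  by rewrite -[leLHS]mulr_natr ler_wpM2l // ler_nat.
have h3 : ((q n) ^ (2 * a) <= n)%N.
  rewrite -(ler_nat R) natrX -ler_ln // ?posrE ?exprn_gt0 ?ltr0n //.
  exact: ltnW.
apply: leq_trans h3; rewrite expnM.
case: a {e0 h1 h h'} => // a; rewrite leq_exp2r //.
by rewrite expnS expn1; nia.
Qed.

Variables (d : measure_display) (Omega : measurableType d) (P : probability Omega R).
Variable G : forall n : nat, Omega -> graph n.
Hypothesis Gmeas : forall n (g : graph n), measurable (G n @^-1` [set g]).
Hypothesis Gunif : forall n, good q n -> forall g : graph n,
  P (G n @^-1` [set g]) =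
    (if g \in Greg n (q n).+1 then ((#|Greg n (q n).+1|%:R : R)^-1)%:E else 0%E).

Lemma measurable_preimage_seq n (l : seq (graph n)) : measurable (G n @^-1` [set` l]).
Proof.
elim: l => [|g l IH]; first by rewrite set_nil preimage_set0.
by rewrite set_seq_cons preimage_setU; exact: measurableU.
Qed.

Lemma probability_preimage_seq n (l : seq (graph n)) :
  (P (G n @^-1` [set` l]) <= \sum_(g <- l) P (G n @^-1` [set g]))%E.
Proof.
elim: l => [|g l IH]; first by rewrite set_nil preimage_set0 measure0 big_nil.
rewrite set_seq_cons preimage_setU big_cons.
apply: (le_trans (measureU2 _ _ _)) => //; first exact: measurable_preimage_seq.
exact: leeD.
Qed.

Lemma ae_regular : {ae P, forall w, forall n, good q n -> regular_graph (q n).+1 (G n w)}.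
Proof.
apply: ae_foralln => n; have [gn|gn] := boolP (good q n); last first.
  by apply: aeW => w.
exists (G n @^-1` [set` [seq g <- enum {: graph n} | g \notin Greg n (q n).+1]]); split.
- exact: measurable_preimage_seq.
- apply/eqP; rewrite eq_le measure_ge0 andbT.
  apply: le_trans (probability_preimage_seq _) _; rewrite big_seq big1 // => g.
  by rewrite mem_filter => /andP[/negbTE gG _]; rewrite Gunif // gG.
- move=> w /= h; rewrite mem_filter mem_enum andbT; apply/negP => gG; apply: h => _.
  by move: gG; rewrite inE.
Qed.

Definition many_cycles L k n : {set graph n} :=
  [set g in Greg n (q n).+1 | (n < #|on_cycle k g| * (q n).+2 ^ (2 * L))%N]%SET.

(** The proportion of such graphs is at most [D ^ a / n ^ 2] with [D = (q n).+2], and [D ^ a] is at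
    most the square root of [n]; this leaves the summable bound [n^(-3/2)]. *)
Lemma probability_many_cycles L k : (2 <= k)%N -> exists N, forall n, (N <= n)%N -> good q n ->
  (P (G n @^-1` [set` enum (many_cycles L k n)]) <= ((n%:R * Num.sqrt n%:R)^-1)%:E)%E.
Proof.
(* The exponent collects the factors of [card_many_on_cycle] for [m = 2 * L]: one power of [D] for
   the constant 2, [4 * L] for [D ^ (2 * m)], and [4 * k.+1] because [2 * (q n).+1 <= D ^ 2]. *)
move=> k2; pose a := (1 + 4 * L + 4 * k.+1)%N.
have [N1 h1] := q_small_power (2 * a); have [N2 h2] := q_inf (k + 8).
exists (maxn N1 N2) => n; rewrite geq_max => /andP[n1 n2] gn.
have /andP[n0 Gn0] := gn; set D := (q n).+2.
have Dn : (D ^ (2 * a) <= n)%N := h1 n n1.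
have Dk : (k + 10 <= D)%N by have := h2 n n2; rewrite /D; lia.
have leD i : (i <= 2 * a)%N -> (D ^ i <= n)%N.
  by move=> ia; apply: leq_trans Dn; rewrite leq_pexp2l.
have c1 : (4 * ((q n).+1 + 2) + 4 * (2 * k.+1) <= n)%N.
  apply: leq_trans (leD 3 _); last by rewrite /a; lia.
  by move: Dk; rewrite /D !expnS expn0 => Dk; nia.
have c2 : (2 * (q n).+2 ^ (2 * k + 2 * L) <= n)%N.
  apply: leq_trans (leD (2 * k + 2 * L).+1 _); last by rewrite /a; lia.
  by rewrite expnS leq_mul2r -/D; apply/orP; right; lia.
have card := card_many_on_cycle k2 (ltn0Sn (q n)) c1 c2.
have G0 : (0 < #|Greg n (q n).+1|)%N by rewrite card_gt0.
set A := many_cycles L k n.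
have cardA : (#|A| * n ^ 2 <= D ^ a * #|Greg n (q n).+1|)%N.
  apply: leq_trans card _; rewrite mulnA leq_mul2r; apply/orP; right.
  have -> : (D ^ a = D * D ^ (2 * (2 * L)) * (D ^ 2) ^ (2 * k.+1))%N.
    by rewrite -expnM -expnS -expnD; congr (_ ^ _)%N; rewrite /a; lia.
  apply: leq_mul; first by apply: leq_mul => //; rewrite /D.
  by rewrite leq_exp2r // expnS expn1 /D; nia.
apply: le_trans (probability_preimage_seq _) _.
rewrite big_seq (eq_bigr (fun=> ((#|Greg n (q n).+1|%:R : R)^-1)%:E)) => [|g]; last first.
  by rewrite mem_enum inE => /andP[gG _]; rewrite Gunif // gG.
rewrite -big_seq sumEFin lee_fin big_const_seq count_predT iter_addr_0 -cardE.
rewrite -[leLHS]mulr_natl.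
have n0' : 0 < n%:R :> R by rewrite ltr0n.
have G0' : 0 < #|Greg n (q n).+1|%:R :> R by rewrite ltr0n.
set b := Num.sqrt n%:R.
have b0 : 0 < b by rewrite sqrtr_gt0.
have bE : b ^+ 2 = n%:R by rewrite sqr_sqrtr // ltW.
have Db : (D ^ a)%:R <= b.
  rewrite -[leLHS]ger0_norm // -sqrtr_sqr ler_sqrt // -natrX ler_nat -expnM.
  by rewrite mulnC.
rewrite ler_pdivrMr // mulrC ler_pdivlMr ?mulr_gt0 // -(ler_pM2r b0).
have -> : #|A|%:R * (n%:R * b) * b = (#|A| * n ^ 2)%:R.
  by rewrite natrM natrX -bE; ring.
apply: (@le_trans _ _ (D ^ a * #|Greg n (q n).+1|)%:R); first by rewrite ler_nat.
by rewrite natrM mulrC ler_wpM2l.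
Qed.

Lemma ae_few_cycles : {ae P, forall w, forall L, exists N, forall n, (N <= n)%N ->
  good q n -> regular_graph (q n).+1 (G n w) -> few_cycles (G n w) (q n).+1 L}.
Proof.
apply: ae_foralln => L.
have H : {ae P, forall w, forall k, exists N, forall n, (N <= n)%N -> good q n ->
    regular_graph (q n).+1 (G n w) -> (2 <= k <= L)%N ->
    (#|on_cycle k (G n w)| * (q n).+2 ^ (2 * L) <= n)%N}.
  apply: ae_foralln => k; have [k2|k2] := leqP 2 k; last by apply: aeW => w; exists 0%N.
  have [N hN] := probability_many_cycles L k2.
  pose F n := if good q n then G n @^-1` [set` enum (many_cycles L k n)] else set0.
  (* The shift by one matches [inv_n32_telescope]. Starting at [n = 2] avoids the index where the
     denominator is 0 and the quotient 0 by convention. *)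
  pose v (n : nat) : R := 2 / Num.sqrt n.-1%:R.
  have mF n : measurable (F n).
    by rewrite /F; case: ifP => _; [exact: measurable_preimage_seq|exact: measurable0].
  have v0 n : 0 <= v n by rewrite divr_ge0 // sqrtr_ge0.
  have PF n : (maxn N 2 <= n)%N -> (P (F n) <= (v n - v n.+1)%:E)%E.
    rewrite geq_max => /andP[Nn]; case: n Nn => [//|m] Nm; rewrite ltnS => m0.
    have h : (m.+1%:R * Num.sqrt m.+1%:R)^-1 <= v m.+1 - v m.+2 by exact: inv_n32_telescope.
    rewrite /F; case: ifPn => gm; first by apply: (le_trans (hN _ Nm gm)); rewrite lee_fin.
    rewrite measure0 lee_fin; apply: le_trans h.
    by rewrite invr_ge0 mulr_ge0 // sqrtr_ge0.
  apply: filterS (ae_eventually_not mF v0 PF) => w [M h].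
  exists M => n nM gn rg _; rewrite leqNgt; apply/negP => big.
  by apply: (h n nM); rewrite /F gn /= mem_enum !inE rg big.
apply: filterS H => w h; have [f fP] := choice h.
(* Only finitely many [k] occur in [few_cycles], so their thresholds have a common bound. *)
exists (\max_(k < L.+1) f k) => n nN gn rg k kL; apply: fP => //.
have kL1 : (k < L.+1)%N by case/andP: kL.
exact: leq_trans (leq_bigmax (Ordinal kL1)) nN.
Qed.

End RandomGraphs.

Theorem theorem4p1 (R : realType) (q : nat -> nat)
  (hq0 : forall n, (0 < q n)%N)
  (hqinf : forall M : nat, exists N : nat, forall n, (N <= n)%N -> (M <= q n)%N)
  (hqlog : (fun n : nat => ln ((q n)%:R : R) / ln (n%:R : R)) @ \oo --> (0 : R))
  (d : measure_display) (Omega : measurableType d) (P : probability Omega R)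
  (G : forall n : nat, Omega -> graph n)
  (Gmeas : forall n (g : graph n), measurable (G n @^-1` [set g]))
  (Gunif : forall n, good q n -> forall g : graph n,
     P (G n @^-1` [set g]) =
       (if g \in Greg n (q n).+1 then ((#|Greg n (q n).+1|%:R : R)^-1)%:E else 0%E))
  (Gindep : forall (N : nat) (A : forall n, set (graph n)),
     (forall j, (j < N)%N -> ~~ good q j -> A j = setT) ->
     P (\bigcap_(j in `I_N) (G j @^-1` A j)) = (\prod_(j < N) P (G j @^-1` A j))%E) :
  {ae P, forall w : Omega, forall p : R, 1 <= p -> forall e : R, 0 < e ->
     exists N : nat, forall n, (N <= n)%N -> good q n ->
       (Wasserstein p (@spectral_measure R (q n) n (G n w)) (@semicircle R) < e%:E)%E}.
Proof.
have h1 := ae_regular Gmeas Gunif.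
have h2 := ae_few_cycles hq0 hqinf hqlog Gmeas Gunif.
(* The exceptional event depends on neither [p] nor [e]; outside it the argument is deterministic,
   which gives all [p] simultaneously. *)
apply: filterS (filterI h1 h2) => w [{}h1 {}h2] p p1 e e0.
apply: (@Wasserstein_cvg R q (fun n => G n w)) => // L.
by have [N hN] := h2 L; exists N => n nN gn; exact: hN (h1 n gn).
Qed.
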